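(* Let $\mathcal{Z}=\mathcal{S}(\{Z_1,\ldots,Z_r\})$ be an involutive distribution of rank $r<n$ on an open set $U\subseteq\mathbb{R}^n$, and let $X$ be a $\mathcal{C}^{\infty}$-symmetry of $\mathcal{Z}$. Then there exists, at least locally, a symmetrizing factor for $X$ with respect to $\mathcal{Z}$; that is, every point of $U$ has an open neighbourhood $W\subseteq U$ on which there is a non-vanishing smooth function $f$ such that $fX$ is a symmetry of the restriction of $\mathcal{Z}$ to $W$.
   Context: Vector fields are called independent on $U$ if they are pointwise linearly independent at every point of $U$. $\mathcal{S}(B)$ denotes the $\mathcal{C}^\infty(U)$-submodule of the smooth vector fields on $U$ generated by $B$. A rank $r$ distribution on $U$ is a submodule $\mathcal{S}(\{Z_1,\ldots,Z_r\})$ with $Z_1,\ldots,Z_r$ independent vector fields on $U$; it is involutive if it is closed under the Lie bracket. A vector field $X$ on $U$ such that $\{Z_1,\ldots,Z_r,X\}$ is independent on $U$ is a $\mathcal{C}^{\infty}$-symmetry of the involutive distribution $\mathcal{Z}=\mathcal{S}(\{Z_1,\ldots,Z_r\})$ if $\mathcal{S}(\{Z_1,\ldots,Z_r,X\})$ is involutive, i.e. there are smooth functions $\lambda_i,c_{ik}$ on $U$ with $[X,Z_i]=\lambda_iX+\sum_{k=1}^r c_{ik}Z_k$ for $1\le i\le r$. It is a symmetry of $\mathcal{Z}$ if moreover all $\lambda_i=0$. A non-vanishing smooth function $f$ is a symmetrizing factor of $X$ with respect to $\mathcal{Z}$ if $fX$ is a symmetry of $\mathcal{Z}$. *)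

(* Defs.v *)
From HB Require Import structures.
From mathcomp Require Import all_boot all_order all_algebra.
From mathcomp Require Import all_classical all_reals all_analysis.

Set Implicit Arguments.
Unset Strict Implicit.
Unset Printing Implicit Defensive.

Import Order.TTheory GRing.Theory Num.Theory.
Import numFieldNormedType.Exports.

Local Open Scope classical_set_scope.
Local Open Scope ring_scope.

(* Functions and vector fields on an open set U are represented by total
   functions on R^n.  Every predicate below depends only on their values on U,
   because the derivatives at a point of an open set are local. *)

Section Smooth.
Context {R : realType} {V W : normedModType R}.

(* f is of class C^(k+1) on U iff it is differentiable on U and its derivative
   is of class C^k; in finite dimension the latter amounts to every
   p |-> (df_p)(v) = 'D_v f p being of class C^k. *)
Fixpoint Ck_on (k : nat) (U : set V) (f : V -> W) : Prop :=
  if k is k'.+1 then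
    (forall p, U p -> differentiable f p) /\
    (forall v, Ck_on k' U (fun p => 'D_v f p))
  else forall p, U p -> {for p, continuous f}.

Definition smooth_on (U : set V) (f : V -> W) : Prop :=
  forall k, Ck_on k U f.

End Smooth.

Section VectorFields.
Context {R : realType} {n : nat}.

Definition scalar_field : Type := 'rV[R]_n -> R^o.

Definition vector_field : Type := 'rV[R]_n -> 'rV[R]_n.

Implicit Types (U : set 'rV[R]_n) (X Y : vector_field) (f : scalar_field).

Definition scale_field f X : vector_field := fun p => f p *: X p.

(* Coordinates of the commutator g |-> X(Y g) - Y(X g). *)
Definition lie_bracket X Y : vector_field :=
  fun p => 'D_(X p) Y p - 'D_(Y p) X p.

Definition independent_on m U (B : 'I_m -> vector_field) : Prop :=
  forall p, U p -> row_free (\matrix_(i < m) B i p).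

(* S(B): the C^oo(U)-module generated by a finite family B.  Its elements are
   smooth on U as soon as the members of B are. *)
Definition span_on m U (B : 'I_m -> vector_field) : set vector_field :=
  [set Y | exists a : 'I_m -> scalar_field,
     (forall i, smooth_on U (a i)) /\
     (forall p, U p -> Y p = \sum_(i < m) a i p *: B i p)].

Definition is_involutive (D : set vector_field) : Prop :=
  forall Y1 Y2, D Y1 -> D Y2 -> D (lie_bracket Y1 Y2).

(* Z_1, ..., Z_r generate a rank r distribution on U. *)
Definition distribution_frame r U (Z : 'I_r -> vector_field) : Prop :=
  (forall i, smooth_on U (Z i)) /\ independent_on U Z.

Definition adjoin r (Z : 'I_r -> vector_field) X : 'I_r.+1 -> vector_field :=
  fun i => if unlift ord_max i is Some j then Z j else X.

Definition is_Cinf_symmetry r U (Z : 'I_r -> vector_field) X : Prop :=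
  [/\ smooth_on U X,
      independent_on U (adjoin Z X) &
      is_involutive (span_on U (adjoin Z X))].

Definition structure_equations r U (Z : 'I_r -> vector_field) X
    (lam : 'I_r -> scalar_field) (c : 'I_r -> 'I_r -> scalar_field) : Prop :=
  [/\ (forall i, smooth_on U (lam i)),
      (forall i k, smooth_on U (c i k)) &
      (forall i p, U p -> lie_bracket X (Z i) p =
         lam i p *: X p + \sum_(k < r) c i k p *: Z k p)].

(* The coefficients lam and c are unique on U, because Z_1, ..., Z_r, X are
   independent there. *)
Definition is_symmetry r U (Z : 'I_r -> vector_field) X : Prop :=
  is_Cinf_symmetry U Z X /\
  exists (lam : 'I_r -> scalar_field) (c : 'I_r -> 'I_r -> scalar_field),
    structure_equations U Z X lam c /\
    (forall i p, U p -> lam i p = 0).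

Definition is_symmetrizing_factor r U (Z : 'I_r -> vector_field) X f : Prop :=
  [/\ smooth_on U f,
      (forall p, U p -> f p != 0) &
      is_symmetry U Z (scale_field f X)].

End VectorFields.

Arguments scalar_field : clear implicits.
Arguments vector_field : clear implicits.

(* Main.v *)
(* A first integral h of the distribution with Xh <> 0 gives the factor
   f = 1/(Xh): from Z_i h = 0 and [X, Z_i] = lam_i X + ... one gets
   Z_i(Xh) = - lam_i Xh, that is, Z_i f = lam_i f, and then
   [fX, Z_i] = f lam_i X - (Z_i f) X + ... has no X component.

   First integrals come from the following form of the Frobenius theorem.
   Choose a constant matrix A such that Z(p) A is invertible, and replace the
   frame Z by Y = (ZA)^-1 Z, for which Y_i A is the i-th unit vector; the
   brackets [Y_i, Y_j] lie in the span of Y and are killed by A, so they vanish.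
   With x(q) = (q - p) A, let u be the solution of u' = - \sum_i x_i(q) Y_i(u),
   u(0) = q, on [0, 1], and H(q) = u(1).  Since the Y_i commute, the derivative
   of u in the direction Y_j(q) is (1 - t) Y_j(u(t)), so Y_j H = 0; moreover dH
   is the identity on ker A at p.

   The solution is the fixed point of a contraction of the Banach space of
   continuous paths, depending smoothly on q and on the path; a fixed point
   theorem with smooth parameters makes it smooth in q. *)
Require Import Defs.
From HB Require Import structures.
From mathcomp Require Import all_boot all_order all_algebra.
From mathcomp Require Import all_classical all_reals all_analysis.
From mathcomp Require Import ring lra.

Set Implicit Arguments.
Unset Strict Implicit.
Unset Printing Implicit Defensive.

Import Order.TTheory GRing.Theory Num.Theory.
Import numFieldNormedType.Exports.

Local Open Scope classical_set_scope.
Local Open Scope ring_scope.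

(** * Tangent-map calculus of C^k functions *)

(** Geometrically, Y_i A being the i-th unit vector gives x(u(t)) = (1 - t) x(q): H slides q inside
    its leaf, along a straight line in x, to the slice x = 0 through p. One equation with parameter
    q replaces a composition of r flows, so a single fixed point argument suffices. The price is
    that q enters both the initial value and the coefficients, and that the unknown lies in an
    infinite-dimensional space, where derivatives in fixed directions no longer control the
    differential. This is why regularity is measured by [Tk], which iterates the tangent map. The
    tangent map of a composite, of a superposition operator or of a fixed point is an object of the
    same kind over a doubled space, so each smoothness proof is an induction on k and no space of
    operators is needed. [Ck_on] is translated into [Tk] and back only for functions on R^n. H has
    values in R^n, and its differential at p has rank n - r. The scalar first integral h is one
    coordinate of H, selected only once X is known to be transverse to the frame at p. *)

Section Differentiability.
Context {R : realType} {V W : normedModType R}.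

Lemma differentiable_estimate (f : V -> W) x : differentiable f x ->
  forall e, 0 < e -> exists2 d, 0 < d &
    forall h, `|h| < d -> `|f (x + h) - f x - 'd f x h| <= e * `|h|.
Proof.
move=> df e e0; have := diff_locally df.
move=> /eqaddoP /(_ _ e0) /nbhs_normP[d /= d0 H].
exists d => // h hd; have := H h; rewrite /= sub0r normrN => /(_ hd).
by rewrite fctE /= opprD addrA [h + x]addrC.
Qed.

Lemma differentiable_bound (f : V -> W) x : differentiable f x ->
  exists2 C, 0 < C & forall h, `|'d f x h| <= C * `|h|.
Proof.
move=> df; have /linear_lipschitz[C C0 H] := diff_continuous df.
by exists C.
Qed.

(** The norm bound on the candidate [df] supplies its continuity, which is not automatic in infinite
    dimension. *)
Lemma differentiable_of_estimate (f df : V -> W) x C : linear df ->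
  (forall h, `|df h| <= C * `|h|) ->
  (forall e, 0 < e -> exists2 d, 0 < d &
    forall h, `|h| < d -> `|f (x + h) - f x - df h| <= e * `|h|) ->
  differentiable f x /\ 'd f x = df :> (V -> W).
Proof.
move=> dflin dfC H.
pose L : {linear V -> W} := HB.pack df (GRing.isLinear.Build _ _ _ _ df dflin).
have Lc : continuous L.
  apply: bounded_linear_continuous; apply/linear_boundedP.
  near=> r => y; apply: le_trans (dfC y) _; rewrite ler_wpM2r//.
have Lo : f \o shift x = cst (f x) + L +o_ 0 id.
  apply/eqaddoP => e e0; have [d d0 Hd] := H e e0.
  apply/nbhs_normP; exists d => // h /=; rewrite sub0r normrN => hd.
  by rewrite fctE /= opprD addrA [h + x]addrC; exact: Hd.
have dE : 'd f x = L :> (V -> W) by exact: diff_unique.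
split; last exact: dE.
by apply/diff_locallyP; rewrite dE.
Unshelve. all: by end_near. Qed.

End Differentiability.

Section NearEq.
Context {R : realType} {V W : normedModType R}.

Lemma near_eq_differentiable (f g : V -> W) x :
  {near x, f =1 g} -> differentiable f x ->
  differentiable g x /\ 'd g x = 'd f x :> (V -> W).
Proof.
move=> fg df; have [C C0 HC] := differentiable_bound df.
apply: (@differentiable_of_estimate _ _ _ _ _ _ C) => //.
  by move=> a u v; rewrite linearP.
move=> e e0; have [d d0 H] := differentiable_estimate df e0.
move/nbhs_normP: (fg) => [d' /= d'0 H'].
exists (Num.min d d'); first by rewrite lt_min d0.
move=> h; rewrite lt_min => /andP[hd hd'].
have <- : f x = g x by apply: H'; rewrite /= subrr normr0.
have <- : f (x + h) = g (x + h).
  by apply: H'; rewrite /= opprD addrA subrr sub0r normrN.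
exact: H.
Qed.

End NearEq.

Definition tang {R : realType} {V W : normedModType R} (f : V -> W) : V * V -> W :=
  fun z => 'd f (z.1 : V) z.2.

(* C^k regularity phrased with the tangent map (p, v) |-> 'd f p v, jointly in
   (p, v).  Unlike Ck_on, it is stable under composition between arbitrary
   normed spaces. *)
Fixpoint Tk {R : realType} k {V W : normedModType R} (U : set V) (f : V -> W)
    : Prop :=
  if k is k'.+1 then
    (forall p, U p -> differentiable f p) /\
    @Tk R k' (V * V)%type W [set z | U z.1] (tang f)
  else forall p, U p -> {for p, continuous f}.

Lemma open_fst {R : realType} {V W : normedModType R} (U : set V) :
  open U -> open [set z : V * W | U z.1].
Proof. by move=> oU; apply: (@open_comp _ _ fst) => // z _; exact: cvg_fst. Qed.

Section TkBasic.
Context {R : realType}.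
Implicit Types V W : normedModType R.

Lemma Tk_ext k V W (U : set V) (f g : V -> W) : open U ->
  (forall p, U p -> f p = g p) -> Tk k U f -> Tk k U g.
Proof.
elim: k V W U f g => [|k IH] V W U f g oU fg /=.
  move=> H p Up; have near : {near p, f =1 g}.
    by apply: filterS (open_nbhs_nbhs (conj oU Up)) => y /fg.
  rewrite /prop_for /continuous_at -(fg _ Up).
  by apply: cvg_trans (H p Up); apply: near_eq_cvg.
move=> [df H].
have dg p : U p -> differentiable g p /\ 'd g p = 'd f p :> (V -> W).
  move=> Up; apply: near_eq_differentiable; last exact: df.
  by apply: filterS (open_nbhs_nbhs (conj oU Up)) => y /fg.
split=> [p /dg[]//|]; apply: IH H; first exact: open_fst.
by move=> [p v] /= /dg[_]; rewrite /tang /= => ->.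
Qed.

Lemma TkS k V W (U : set V) (f : V -> W) : Tk k.+1 U f -> Tk k U f.
Proof.
elim: k V W U f => [|k IH] V W U f /= [df H].
  by move=> p Up; exact/differentiable_continuous/df.
by split=> //; apply: IH.
Qed.

Lemma Tk_sub k V W (U U' : set V) (f : V -> W) : U' `<=` U ->
  Tk k U f -> Tk k U' f.
Proof.
elim: k V W U U' f => [|k IH] V W U U' f UU' /=.
  by move=> H p /UU' /H.
by case=> df H; split=> [p /UU' /df//|]; apply: IH H => z /= /UU'.
Qed.

(** The tangent map of a continuous linear f is [f \o snd], again linear and continuous, so the
    induction closes. *)
Lemma Tk_linear k V W (U : set V) (f : V -> W) : linear f -> continuous f ->
  Tk k U f.
Proof.
elim: k V W U f => [|k IH] V W U f flin fc /=; first by move=> p _; exact: fc.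
pose L : {linear V -> W} := HB.pack f (GRing.isLinear.Build _ _ _ _ f flin).
split=> [p _|]; first exact: (@linear_differentiable _ _ _ L).
have -> : tang f = f \o snd.
  by apply/funext => -[p v]; rewrite /tang /= (@diff_lin _ _ _ L).
apply: IH; first by move=> a u v /=; rewrite flin.
by move=> z; apply: continuous_comp; [exact: cvg_snd|exact: fc].
Qed.

Lemma Tk_fst k V W (U : set (V * W)) : Tk k U fst.
Proof.
apply: Tk_linear; first by move=> a u v.
by move=> z; exact: cvg_fst.
Qed.

Lemma Tk_snd k V W (U : set (V * W)) : Tk k U snd.
Proof.
apply: Tk_linear; first by move=> a u v.
by move=> z; exact: cvg_snd.
Qed.

Lemma Tk_id k V (U : set V) : Tk k U id.
Proof. by apply: Tk_linear; [move=> a u v|move=> z; exact: cvg_id]. Qed.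

Lemma Tk_cst k V W (U : set V) (c : W) : Tk k U (cst c).
Proof.
elim: k V W U c => [|k IH] V W U c /=; first by move=> p _; exact: cst_continuous.
split=> [p _|]; first exact: differentiable_cst.
have -> : tang (cst c : V -> W) = cst 0.
  by apply/funext => -[p v]; rewrite /tang /= diff_cst.
exact: IH.
Qed.

Lemma Tk_pair k V W W' (U : set V) (f : V -> W) (g : V -> W') : open U ->
  Tk k U f -> Tk k U g -> Tk k U (fun p => (f p, g p)).
Proof.
elim: k V W W' U f g => [|k IH] V W W' U f g oU /=.
  by move=> cf cg p Up; apply: cvg_pair; [exact: cf|exact: cg].
move=> [df Hf] [dg Hg]; split=> [p Up|].
  by apply: differentiable_pair; [exact: df|exact: dg].
apply: Tk_ext (IH _ _ _ _ _ _ _ Hf Hg); try exact: open_fst.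
by move=> [p v] /= Up; rewrite /tang /= diff_pair; [|exact: df|exact: dg].
Qed.

(** The chain rule says that the tangent map of the composite is [tang g] after (f(p), 'd f p v).
    This is a composite of maps of class one less, to which the induction hypothesis applies. The
    component f(p) is itself a composite with [fst] and uses the induction hypothesis once more. *)
Lemma Tk_comp k V V' W (U : set V) (U' : set V') (f : V -> V') (g : V' -> W) :
  open U -> (forall p, U p -> U' (f p)) ->
  Tk k U f -> Tk k U' g -> Tk k U (fun p => g (f p)).
Proof.
elim: k V V' W U U' f g => [|k IH] V V' W U U' f g oU UU' /=.
  by move=> cf cg p Up; apply: continuous_comp; [exact: cf|exact/cg/UU'].
move=> TSf TSg; have [[df Hf] [dg Hg]] := (TSf, TSg); split=> [p Up|].
  by apply: (@differentiable_comp _ _ _ _ f g); [exact: df|exact/dg/UU'].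
have ff : Tk k [set z : V * V | U z.1] (fun z => f z.1).
  by apply: IH (Tk_fst _ _) (TkS TSf) => //; exact: open_fst.
have := IH _ _ _ _ _ (fun z : V * V => (f z.1, tang f z)) _ _ _ _ Hg.
move=> /(_ [set z | U z.1] (open_fst oU)) H.
apply: Tk_ext (H _ _); first exact: open_fst.
- move=> [p v] /= Up; rewrite /tang /=.
  have /= -> := @diff_comp _ _ _ _ f g p (df _ Up) (dg _ (UU' _ Up)).
  by [].
- by move=> [p v] /= /UU'.
- by apply: Tk_pair => //; exact: open_fst.
Qed.

Lemma TkD k V W (U : set V) (f g : V -> W) : open U ->
  Tk k U f -> Tk k U g -> Tk k U (fun p => f p + g p).
Proof.
elim: k V W U f g => [|k IH] V W U f g oU /=.
  by move=> cf cg p Up; apply: cvgD; [exact: cf|exact: cg].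
move=> [df Hf] [dg Hg]; split=> [p Up|].
  by apply: differentiableD; [exact: df|exact: dg].
apply: Tk_ext (IH _ _ _ _ _ _ Hf Hg); try exact: open_fst.
move=> [p v] /= Up.
exact: (esym (congr1 (@^~ v) (diffD (df _ Up) (dg _ Up)))).
Qed.

Lemma Tk_sum k V W (U : set V) (I : Type) (s : seq I) (P : pred I)
    (f : I -> V -> W) : open U ->
  (forall i, Tk k U (f i)) -> Tk k U (fun p => \sum_(i <- s | P i) f i p).
Proof.
move=> oU Hf; elim: s => [|i s IH].
  have -> : (fun p => \sum_(i <- [::] | P i) f i p) = cst 0.
    by apply/funext => p; rewrite big_nil.
  exact: Tk_cst.
have [Pi|Pi] := boolP (P i).
  have -> : (fun p => \sum_(j <- i :: s | P j) f j p) =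
            (fun p => f i p + \sum_(j <- s | P j) f j p).
    by apply/funext => p; rewrite big_cons Pi.
  exact: TkD.
have -> : (fun p => \sum_(j <- i :: s | P j) f j p) =
          (fun p => \sum_(j <- s | P j) f j p).
  by apply/funext => p; rewrite big_cons (negbTE Pi).
exact: IH.
Qed.

Lemma TkN k V W (U : set V) (f : V -> W) : open U ->
  Tk k U f -> Tk k U (fun p => - f p).
Proof.
move=> oU Hf; apply: (Tk_comp (U' := setT) oU _ Hf (g := -%R)) => //.
apply: Tk_linear; first by move=> a u v; rewrite opprD scalerN.
exact: opp_continuous.
Qed.

End TkBasic.

(** * Products, inverses, determinants, and comparison with C^k on R^n *)

Section TkAlgebra.
Context {R : realType}.
Implicit Types V W : normedModType R.

Fact scale_is_bilinear W : bilinear_for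
    (GRing.Scale.Law.clone _ _ *:%R _) (GRing.Scale.Law.clone _ _ *:%R _)
    (@GRing.scale R W : R^o -> W -> W).
Proof.
split=> [u'|u] a x y /=; first by rewrite scalerDl scalerA.
by rewrite scalerDr !scalerA mulrC.
Qed.
HB.instance Definition _ W := bilinear_isBilinear.Build R R^o W W _ _
  (@GRing.scale R W : R^o -> W -> W) (scale_is_bilinear W).

(** The tangent map, a w' + a' w, is a sum of two multiplications precomposed with linear maps, so
    multiplication itself drives the induction and the product rule follows by composition. *)
Lemma Tk_scale_pair k W (U : set (R^o * W)) :
  Tk k U (fun q : R^o * W => q.1 *: q.2).
Proof.
have sc : continuous (fun q : R^o * W => q.1 *: q.2).
  exact: scale_continuous.
apply: (@Tk_sub _ _ _ _ setT) => //; elim: k => [|k IH] /=; first by move=> p _; exact: sc.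
split=> [p _|].
  exact: (@differentiable_bilin _ _ _ _ (@GRing.scale R W : R^o -> W -> W)).
have -> : tang (fun q : R^o * W => q.1 *: q.2) =
    (fun z => z.1.1 *: z.2.2 + z.2.1 *: z.1.2).
  apply/funext => -[p v]; rewrite /tang /=.
  by rewrite (@diff_bilin _ _ _ _ (@GRing.scale R W : R^o -> W -> W)).
have oT : open [set z : (R^o * W) * (R^o * W) | setT z.1] by exact: open_fst openT.
have lin1 : Tk k [set z : (R^o * W) * (R^o * W) | setT z.1] (fun z => (z.1.1, z.2.2)).
  by apply: Tk_pair => //; [apply: (Tk_comp (U' := setT) oT _ (Tk_fst _ _) (Tk_fst _ _))|
    apply: (Tk_comp (U' := setT) oT _ (Tk_snd _ _) (Tk_snd _ _))].
have lin2 : Tk k [set z : (R^o * W) * (R^o * W) | setT z.1] (fun z => (z.2.1, z.1.2)).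
  by apply: Tk_pair => //; [apply: (Tk_comp (U' := setT) oT _ (Tk_snd _ _) (Tk_fst _ _))|
    apply: (Tk_comp (U' := setT) oT _ (Tk_fst _ _) (Tk_snd _ _))].
apply: TkD => //.
- exact: (Tk_comp oT _ lin1 IH).
- exact: (Tk_comp oT _ lin2 IH).
Qed.

Lemma Tk_scale k V W (U : set V) (a : V -> R^o) (f : V -> W) : open U ->
  Tk k U a -> Tk k U f -> Tk k U (fun p => a p *: f p).
Proof.
move=> oU Ha Hf.
exact: (Tk_comp oU _ (Tk_pair oU Ha Hf) (Tk_scale_pair k setT)).
Qed.

Lemma TkM k V (U : set V) (a b : V -> R^o) : open U ->
  Tk k U a -> Tk k U b -> Tk k U (fun p => a p * b p : R^o).
Proof. exact: Tk_scale. Qed.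

Lemma TkB k V W (U : set V) (f g : V -> W) : open U ->
  Tk k U f -> Tk k U g -> Tk k U (fun p => f p - g p).
Proof. by move=> oU Hf Hg; apply: TkD => //; exact: TkN. Qed.

Lemma Tk_prod k V (U : set V) (I : Type) (s : seq I) (P : pred I)
    (f : I -> V -> R^o) : open U ->
  (forall i, Tk k U (f i)) -> Tk k U (fun p => \prod_(i <- s | P i) f i p : R^o).
Proof.
move=> oU Hf; elim: s => [|i s IH].
  have -> : (fun p => \prod_(i <- [::] | P i) f i p) = cst 1.
    by apply/funext => p; rewrite big_nil.
  exact: Tk_cst.
have [Pi|Pi] := boolP (P i).
  have -> : (fun p => \prod_(j <- i :: s | P j) f j p) =
            (fun p => f i p * \prod_(j <- s | P j) f j p).
    by apply/funext => p; rewrite big_cons Pi.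
  exact: TkM.
have -> : (fun p => \prod_(j <- i :: s | P j) f j p) =
          (fun p => \prod_(j <- s | P j) f j p).
  by apply/funext => p; rewrite big_cons (negbTE Pi).
exact: IH.
Qed.

Lemma open_neq0 : open [set x : R^o | x != 0].
Proof.
rewrite (_ : mkset _ = ~` [set 0]); last by apply/seteqP; split=> x /= /eqP.
exact/closed_openC/accessible_closed_set1/hausdorff_accessible/norm_hausdorff.
Qed.

Lemma Tk_inv k : Tk k [set x : R^o | x != 0] (fun x : R^o => x^-1 : R^o).
Proof.
have o0 := open_neq0.
elim: k => [|k IH] /=; first by move=> p p0; exact: inv_continuous.
split=> [p p0|]; first exact: differentiable_Rinv.
have oF := open_fst (W := R^o) o0.
have T1 : Tk k [set z : R^o * R^o | z.1 != 0] (fun z => z.1^-1 : R^o).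
  by apply: (Tk_comp oF _ (Tk_fst _ _) IH).
apply: (@Tk_ext R k (R^o * R^o)%type R^o _ (fun z => - (z.1^-1 * z.1^-1 * z.2) : R^o) _ oF).
  move=> [p v] /= p0; rewrite /tang /= diff_Rinv// scaleNr; congr (- _).
  by rewrite -invfM -expr2.
by apply: TkN => //; apply: TkM => //; [apply: TkM|exact: Tk_snd].
Qed.

Lemma TkV k V (U : set V) (a : V -> R^o) : open U ->
  (forall p, U p -> a p != 0) -> Tk k U a -> Tk k U (fun p => (a p)^-1 : R^o).
Proof. by move=> oU a0 Ha; apply: (Tk_comp oU _ Ha (Tk_inv k)). Qed.

Lemma Tk_coord k V m n (U : set V) (f : V -> 'M[R]_(m, n)) i j : open U ->
  Tk k U f -> Tk k U (fun p => f p i j : R^o).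
Proof.
move=> oU Hf; apply: (@Tk_comp R k V 'M[R]_(m, n) R^o U setT f (fun M => M i j) oU) => //.
apply: Tk_linear; first by move=> a u v; rewrite !mxE.
exact: coord_continuous.
Qed.

Lemma Tk_rV k V n (U : set V) (f : V -> 'rV[R]_n) : open U ->
  (forall j, Tk k U (fun p => f p 0 j : R^o)) -> Tk k U f.
Proof.
move=> oU Hf.
apply: (Tk_ext oU (f := fun p => \sum_j f p 0 j *: delta_mx 0 j)).
  by move=> p _; rewrite -row_sum_delta.
by apply: Tk_sum => // j; apply: Tk_scale => //; exact: Tk_cst.
Qed.

Lemma Tk_det k V n (U : set V) (f : 'I_n -> 'I_n -> V -> R^o) : open U ->
  (forall i j, Tk k U (f i j)) ->
  Tk k U (fun p => \det (\matrix_(i, j) f i j p) : R^o).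
Proof.
move=> oU Hf; rewrite /determinant; apply: Tk_sum => // s.
apply: TkM => //; first exact: Tk_cst.
apply: Tk_prod => // i.
apply: (@Tk_ext R k V R^o U (f i (perm.fun_of_perm s i)) _ oU) => // p _.
by rewrite mxE.
Qed.

Lemma Tk_Ck k V W (U : set V) (f : V -> W) : open U -> Tk k U f -> Ck_on k U f.
Proof.
elim: k V W U f => [|k IH] V W U f oU /=; first by [].
move=> [df Hf]; split=> // v; apply: IH => //.
apply: (Tk_ext oU (f := fun p => tang f (p, v))).
  by move=> p Up; rewrite deriveE//; exact: df.
apply: (Tk_comp (U' := [set z | U z.1]) oU _ _ Hf) => //.
by apply: Tk_pair => //; [exact: Tk_id|exact: Tk_cst].
Qed.

(** Finite dimension enters here: the tangent map is the finite sum of v_j times the j-th partial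
    derivative, and each partial derivative is of class C^k by hypothesis. *)
Lemma Ck_Tk k n W (U : set 'rV[R]_n) (f : 'rV[R]_n -> W) : open U ->
  Ck_on k U f -> Tk k U f.
Proof.
elim: k W f => [|k IH] W f oU /=; first by [].
move=> [df Hf]; split=> //; have oF := open_fst (W := 'rV[R]_n) oU.
apply: (@Tk_ext R k ('rV[R]_n * 'rV[R]_n)%type W _
  (fun z => \sum_j z.2 0 j *: 'D_(delta_mx 0 j) f (z.1 : 'rV[R]_n)) _ oF).
  move=> [p v] /= Up; rewrite /tang /= {2}(row_sum_delta v) linear_sum.
  by apply: eq_bigr => j _; rewrite linearZ deriveE//; exact: df.
apply: Tk_sum => // j; apply: Tk_scale => //.
  by apply: Tk_coord => //; exact: Tk_snd.
by apply: (Tk_comp oF _ (Tk_fst _ _) (IH _ _ oU (Hf (delta_mx 0 j)))).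
Qed.

End TkAlgebra.

(** * Smooth dependence of fixed points on parameters *)

Section FixedPoint.
Context {R : realType}.

Lemma half_le0 (x y : R) : x <= 2^-1 * x + y -> x <= 2 * y.
Proof. lra. Qed.

Lemma half_contraction_fix (E : completeNormedModType R) (U : set E) (f : E -> E) :
  closed U -> U !=set0 -> (forall x, U x -> U (f x)) ->
  (forall x y, U x -> U y -> `|f x - f y| <= 2^-1 * `|x - y|) ->
  exists2 x, U x & x = f x.
Proof.
move=> cU U0 fU fc.
pose g : {fun U >-> U} := HB.pack f (isFun.Build _ _ _ _ f fU).
apply: (@banach_fixed_point R E U g) => //.
exists (2^-1)%:nng; split; first by rewrite /=; lra.
by move=> [x y] /= [Ux Uy]; exact: fc.
Qed.

Variables (V : normedModType R) (E : completeNormedModType R).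
Variables (W : set V) (O : set E) (T : V * E -> E) (u : V -> E).
Hypotheses (oW : open W) (oO : open O).
Hypothesis uO : forall q, W q -> O (u q).
Hypothesis uT : forall q, W q -> u q = T (q, u q).
Hypothesis contrT : forall q e e', W q -> O e -> O e' ->
  `|T (q, e) - T (q, e')| <= 2^-1 * `|e - e'|.

Lemma fixed_point_continuous q : W q -> {for (q, u q), continuous T} ->
  {for q, continuous u}.
Proof.
move=> Wq cT; apply/cvgrPdist_lt => e e0.
have : {for q, continuous (fun x => T (x, u q))}.
  apply: (@continuous_comp _ _ _ (fun x => (x, u q)) T) cT.
  by apply: cvg_pair; [exact: cvg_id|exact: cvg_cst].
have e2 : 0 < e / 2 by lra.
move/cvgrPdist_lt => /(_ _ e2) H.
have H' : \forall x \near q, W x by exact: open_nbhs_nbhs.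
near=> x.
have Wx : W x by near: x.
have Hx : `|T (q, u q) - T (x, u q)| < e / 2 by near: x.
have := contrT Wx (uO Wq) (uO Wx); rewrite -uT// => Hc.
have : `|u q - u x| <= `|T (q, u q) - T (x, u q)| + `|T (x, u q) - u x|.
  by rewrite [in leLHS](uT Wq); exact: ler_distD.
by move: Hc Hx; lra.
Unshelve. all: by end_near. Qed.

(** Differentiating the contraction estimate keeps its constant. Hence the linearized fixed point
    equation is again a contraction, which both solves it and drives the induction on the order of
    smoothness. *)
Lemma fixed_point_partial_bound q e : W q -> differentiable T (q, u q) ->
  `|'d T (q, u q) (0, e)| <= 2^-1 * `|e|.
Proof.
move=> Wq dT; have [->|e0] := eqVneq e 0.
  by rewrite (_ : (0, 0) = 0)// linear0 !normr0 mulr0.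
have ne0 : 0 < `|e| by rewrite normr_gt0.
apply/ler_addgt0Pr => eps eps0.
have eps1 : 0 < eps / `|e| by rewrite divr_gt0.
have [d d0 H] := differentiable_estimate dT eps1.
have /nbhs_normP[d' /= d'0 H'] : \forall x \near u q, O x.
  by apply: open_nbhs_nbhs; split=> //; exact: uO.
pose m := Num.min d d'.
have m0 : 0 < m by rewrite lt_min d0.
(* This scales e to norm m / 2, inside both the radius of the differentiability estimate and the
   neighbourhood on which T contracts; s cancels at the end by linearity. *)
pose s := m / (2 * `|e|).
have s0 : 0 < s by rewrite divr_gt0// mulr_gt0.
have se : `|s *: e| = m / 2.
  by rewrite normrZ (gtr0_norm s0) /s invfM -!mulrA mulVf ?mulr1// gt_eqF.
have sem : `|s *: e| < m by rewrite se; lra.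
clearbody s.
have Ose : O (u q + s *: e).
  apply: H'; rewrite /= opprD addrA subrr sub0r normrN.
  by apply: lt_le_trans sem _; rewrite ge_min lexx orbT.
have := H (0, s *: e).
have -> : `|((0 : V), s *: e)| = `|s *: e|.
  by rewrite prod_normE /= normr0 max_r.
move=> /(_ (lt_le_trans sem _)); rewrite ge_min lexx /= => /(_ isT).
have -> : (q, u q) + (0, s *: e) = (q, u q + s *: e).
  by apply/pair_equal_spec; rewrite /= addr0.
have -> : ((0 : V), s *: e) = s *: (0, e).
  by apply/pair_equal_spec; rewrite /= scaler0.
rewrite linearZ /= => Hd.
have Hc := contrT Wq Ose (uO Wq).
rewrite addrAC subrr add0r in Hc.
have : `|s *: 'd T (q, u q) (0, e)| <= 2^-1 * `|s *: e| + eps / `|e| * `|s *: e|.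
  apply: le_trans (lerD Hc Hd).
  rewrite -[X in `|X| <= _](subKr (T (q, u q + s *: e) - T (q, u q))).
  exact: ler_normB.
rewrite !normrZ (gtr0_norm s0) -mulrDl mulrCA (ler_pM2l s0).
by rewrite mulrDl divfK// gt_eqF.
Qed.

(** The candidate derivative w v is the fixed point of e |-> L (v, e), where L is the differential
    of T. No inverse of an operator is formed: uniqueness of the fixed point gives linearity of w,
    and the contraction bound gives its continuity. *)
Lemma fixed_point_differentiable q : W q -> differentiable T (q, u q) ->
  differentiable u q /\
  forall v, 'd u q v = 'd T (q, u q) (v, 'd u q v).
Proof.
move=> Wq dT; pose L := 'd T (q, u q).
have Lpair v e : L (v, e) = L (v, 0) + L (0, e).
  rewrite -linearD; congr (L _).
  by apply/pair_equal_spec; rewrite /= addr0 add0r.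
have L0 e : `|L (0, e)| <= 2^-1 * `|e| by exact: fixed_point_partial_bound.
have LB v e e' : L (v, e) - L (v, e') = L (0, e - e').
  rewrite -linearB; congr (L _).
  by apply/pair_equal_spec; rewrite /= subrr.
have ex v : exists e, e = L (v, e).
  have [] := @half_contraction_fix E setT (fun e => L (v, e)) closedT.
  - by exists 0.
  - by [].
  - by move=> x y _ _; rewrite LB.
  - by move=> e _; exists e.
have [w wL] := choice ex.
have uniq v e : e = L (v, e) -> e = w v.
  move=> eL; apply/eqP; rewrite -subr_eq0 -normr_eq0 eq_le normr_ge0 andbT.
  have : `|e - w v| <= 2^-1 * `|e - w v|.
    by rewrite {1}eL {1}(wL v) LB.
  lra.
have wlin : linear w.
  move=> a v v'; apply/esym/uniq.
  rewrite {1}(wL v) {1}(wL v') -linearP; congr (L _).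
have [C C0 HC] := differentiable_bound dT.
have LC v : `|L (v, 0)| <= C * `|v|.
  by apply: le_trans (HC _) _; rewrite prod_normE /= normr0 max_l.
have wC v : `|w v| <= 2 * C * `|v|.
  rewrite -mulrA; apply: half_le0; rewrite {1}wL Lpair.
  by apply: le_trans (ler_normD _ _) _; rewrite addrC lerD.
suff [du duE] : differentiable u q /\ 'd u q = w :> (V -> E).
  by split=> // v; rewrite duE; exact: wL.
apply: (differentiable_of_estimate (C := 2 * C)) => // e e0.
(* The value 1/4, together with the contraction constant 1/2, leaves a quarter of |D| to absorb,
   whence |D| <= (4C + 1) |h|. The second bound turns the final error 2 eps (4C + 1) |h| into at
   most e |h|. *)
pose eps := Num.min 4^-1 (e / (2 * (4 * C + 1))).
have C41 : 0 < 2 * (4 * C + 1) by lra.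
have eps0 : 0 < eps by rewrite lt_min; apply/andP; split; [lra|exact: divr_gt0].
have eps4 : eps <= 4^-1 by rewrite ge_min lexx.
have epse : 2 * eps * (4 * C + 1) <= e.
  rewrite mulrAC mulrC -ler_pdivlMr// ge_min.
  by apply/orP; right.
have [d d0 Hd] := differentiable_estimate dT eps0.
have cu := fixed_point_continuous Wq (differentiable_continuous dT).
have /nbhs_normP[d1 /= d10 H1] : \forall x \near q, W x /\ `|u q - u x| < d.
  apply: filterI; first exact: open_nbhs_nbhs.
  by move/cvgrPdist_lt : cu; exact.
exists (Num.min d d1); first by rewrite lt_min d0.
move=> h; rewrite lt_min => /andP[hd hd1].
have [Wqh uqh] : W (q + h) /\ `|u q - u (q + h)| < d.
  by apply: H1; rewrite /= opprD addrA subrr sub0r normrN.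
set D := u (q + h) - u q.
have Dd : `|D| < d by rewrite distrC.
have := Hd (h, D); rewrite prod_normE /= gt_max hd Dd => /(_ isT).
have -> : (q, u q) + (h, D) = (q + h, u (q + h)).
  by apply/pair_equal_spec; split=> //=; rewrite /D addrC subrK.
rewrite -uT// -uT// -/D -/L => Hrho.
have mx : Num.max `|h| `|D| <= `|h| + `|D|.
  by rewrite ge_max lerDl lerDr !normr_ge0.
have DC : `|D| <= (4 * C + 1) * `|h|.
  have : `|D| <= `|D - L (h, D)| + (`|L (h, 0)| + `|L (0, D)|).
    rewrite -[X in `|X| <= _](subrK (L (h, D))); apply: le_trans (ler_normD _ _) _.
    by rewrite lerD2l Lpair ler_normD.
  have : eps * Num.max `|h| `|D| <= 4^-1 * (`|h| + `|D|).
    by apply: ler_pM => //; rewrite ?ltW// le_max normr_ge0.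
  move: (LC h) (L0 D) Hrho; rewrite mulrDl mul1r; set CC := C * _; move=> *.
  have : 4 * C * `|h| = 4 * CC by rewrite -mulrA.
  by lra.
have mxC : Num.max `|h| `|D| <= (4 * C + 1) * `|h|.
  by rewrite ge_max DC andbT ler_peMl//; lra.
have : `|D - w h| <= 2 * (eps * Num.max `|h| `|D|).
  apply: half_le0.
  (* The error reproduces itself under L (0, -), of norm at most 1/2, up to the differentiability
     remainder; it is therefore at most twice that remainder. *)
  have DE : D - w h = L (0, D - w h) + (D - L (h, D)).
    by rewrite -(LB h) -wL [RHS]addrC subrKA.
  by rewrite {1}DE; apply: le_trans (ler_normD _ _) _; rewrite lerD.
move=> /le_trans; apply.
apply: (@le_trans _ _ (2 * eps * ((4 * C + 1) * `|h|))).
  by rewrite -mulrA ler_pM2l// ler_pM2l.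
by rewrite mulrA ler_wpM2r.
Qed.

End FixedPoint.

(** The tangent map of u is the fixed point, with parameter (q, v), of e |-> 'd T (q, u q) (v, e), a
    contraction on the whole of E. The induction hypothesis applies over V * V, once u is known to
    be of class k so that this new map is too. *)
Lemma Tk_fixed_point {R : realType} k (V : normedModType R)
    (E : completeNormedModType R) (W : set V) (O : set E) (T : V * E -> E)
    (u : V -> E) : open W -> open O ->
  (forall q, W q -> O (u q)) -> (forall q, W q -> u q = T (q, u q)) ->
  (forall q e e', W q -> O e -> O e' ->
    `|T (q, e) - T (q, e')| <= 2^-1 * `|e - e'|) ->
  Tk k [set z | W z.1 /\ O z.2] T -> Tk k W u.
Proof.
elim: k V W O T u => [|k IH] V W O T u oW oO uO uT cT.
  move=> HT q Wq; apply: (fixed_point_continuous oW uO uT cT Wq).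
  by apply: HT => /=; split=> //; exact: uO.
move=> TST; have [dT HT] := TST.
have Tu : Tk k W u by apply: IH uO uT cT (TkS TST).
have du q : W q -> _ := fun Wq =>
  fixed_point_differentiable oW oO uO uT cT Wq (dT (q, u q) (conj Wq (uO _ Wq))).
split=> [q /du[]//|].
apply: (IH (V * V)%type [set z | W z.1] setT
  (fun y => tang T ((y.1.1, u y.1.1), (y.1.2, y.2)))) => //.
- exact: open_fst.
- exact: openT.
- by move=> [q v] /= /du[_]; rewrite /tang /=; apply.
- move=> [q v] e e' /= Wq _ _; rewrite /tang /=.
  have := fixed_point_partial_bound oO uO cT (e - e') Wq
    (dT (q, u q) (conj Wq (uO _ Wq))).
  rewrite -linearB; congr (`| 'd T _ _| <= _).
  by apply/pair_equal_spec; rewrite /= subrr.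
- have -> : [set z : V * V * E | [set z | W z.1] z.1 /\ setT z.2] =
      [set z : V * V * E | [set z | W z.1] z.1].
    by apply/seteqP; split=> z /=; [case|].
  have oF : open [set z : V * V * E | [set z | W z.1] z.1].
    by apply: open_fst; exact: open_fst.
  have T11 : Tk k [set z : V * V * E | [set z | W z.1] z.1] (fun y => y.1.1).
    by apply: (Tk_comp (U' := setT) oF _ (Tk_fst _ _) (Tk_fst _ _)).
  apply: (Tk_comp oF _ _ HT); last first.
    apply: Tk_pair => //; apply: Tk_pair => //.
    + exact: (Tk_comp oF _ T11 Tu).
    + by apply: (Tk_comp (U' := setT) oF _ (Tk_fst _ _) (Tk_snd _ _)).
    + exact: Tk_snd.
  by move=> [[q v] e] /= Wq; split=> //; exact: uO.
Qed.

(** * The Banach space of continuous paths *)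

Section ClampDef.
Context {R : realType}.

Definition clamp01 (t : R) : R := Num.max 0 (Num.min t 1).

Lemma clamp01_id t : 0 <= t <= 1 -> clamp01 t = t.
Proof. by move=> /andP[t0 t1]; rewrite /clamp01 min_l// max_r. Qed.

Lemma clamp01_itv t : `[0, 1]%classic (clamp01 t).
Proof.
by rewrite /= in_itv /= /clamp01 le_max lexx /= ge_max ler01 ge_min lexx orbT.
Qed.

Lemma clamp01K t : clamp01 (clamp01 t) = clamp01 t.
Proof. by apply: clamp01_id; have := clamp01_itv t; rewrite /= in_itv. Qed.

Lemma clamp01_continuous : continuous (clamp01 : R -> R).
Proof.
move=> t; apply: (@continuous_max R R (cst 0) (fun t => Num.min t 1)).
  exact: cst_continuous.
by apply: (@continuous_min R R id (cst 1)); [exact: cvg_id|exact: cst_continuous].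
Qed.

End ClampDef.

Section PathSpace.
Context {R : realType} (V : normedModType R).

Definition is_path (f : R -> V) := continuous f /\ f = f \o clamp01.

Definition path_pred : {pred (R -> V)} := fun f => `[< is_path f >].

Lemma path_predP f : reflect (is_path f) (f \in path_pred).
Proof. exact: asboolP. Qed.

Fact path_submod_closed : submod_closed path_pred.
Proof.
split; first by apply/path_predP; split=> //; exact: cst_continuous.
move=> a f g /path_predP[cf ef] /path_predP[cg eg]; apply/path_predP; split.
  move=> t; apply: continuousD; last exact: cg.
  by apply: continuousZl_tmp; exact: cf.
by rewrite [in LHS]ef [in LHS]eg.
Qed.
HB.instance Definition _ := GRing.isSubmodClosed.Build R (R -> V) path_pred
  path_submod_closed.

(* A continuous path on [0, 1], represented by its extension to R which is
   constant on both sides of [0, 1]. *)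
Record cpath := CPath { path_fun :> R -> V ; _ : path_fun \in path_pred }.
HB.instance Definition _ := [isSub for path_fun].
HB.instance Definition _ := [Choice of cpath by <:].
HB.instance Definition _ := [SubChoice_isSubLmodule of cpath by <:].

Lemma cpath_continuous (u : cpath) : continuous u.
Proof. by have /path_predP[] := valP u. Qed.

Lemma cpath_clamp (u : cpath) t : u (clamp01 t) = u t.
Proof. by have /path_predP[_ /(congr1 (@^~ t))] := valP u. Qed.

Lemma cpathP (u v : cpath) : (forall t, 0 <= t <= 1 -> u t = v t) -> u = v.
Proof.
move=> uv; apply/val_inj/funext => t /=.
by rewrite -cpath_clamp -[RHS]cpath_clamp uv//; have := clamp01_itv t; rewrite /= in_itv.
Qed.

Lemma cpathD (u v : cpath) t : (u + v) t = u t + v t. Proof. by []. Qed.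
Lemma cpathZ a (u : cpath) t : (a *: u) t = a *: u t. Proof. by []. Qed.
Lemma cpathB (u v : cpath) t : (u - v) t = u t - v t. Proof. by []. Qed.

Lemma cpath_image (u : cpath) : range u = u @` `[0, 1]%classic.
Proof.
apply/seteqP; split=> _ [t _ <-]; last by exists t.
by exists (clamp01 t); [exact: clamp01_itv|exact: cpath_clamp].
Qed.

Lemma cpath_compact (u : cpath) : compact (range u).
Proof.
rewrite cpath_image; apply: continuous_compact; last exact: segment_compact.
by apply: continuous_subspaceT; exact: cpath_continuous.
Qed.

Definition path_norm (u : cpath) : R := sup (range (fun t => `|u t|)).

Lemma path_norm_has_sup (u : cpath) : has_sup (range (fun t => `|u t|)).
Proof.
split; first by exists `|u 0|; exists 0.
have [M [_ HM]] := compact_bounded (@cpath_compact u).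
by exists (M + 1) => _ [t _ <-]; apply: (HM (M + 1)); [lra|exists t].
Qed.

Lemma le_path_norm (u : cpath) t : `|u t| <= path_norm u.
Proof.
by apply: ub_le_sup; [have [] := path_norm_has_sup u|exists t].
Qed.

Lemma path_norm_le (u : cpath) M : (forall t, 0 <= t <= 1 -> `|u t| <= M) ->
  path_norm u <= M.
Proof.
move=> uM; apply: ge_sup; first by exists `|u 0|; exists 0.
move=> _ [t _ <-]; rewrite -cpath_clamp; apply: uM.
by have := clamp01_itv t; rewrite /= in_itv.
Qed.

Fact path_normD u v : path_norm (u + v) <= path_norm u + path_norm v.
Proof.
apply: path_norm_le => t _; rewrite cpathD.
by apply: le_trans (ler_normD _ _) (lerD _ _); exact: le_path_norm.
Qed.

Fact path_normZ a u : path_norm (a *: u) = `|a| * path_norm u.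
Proof.
have le b v : path_norm (b *: v) <= `|b| * path_norm v.
  by apply: path_norm_le => t _; rewrite cpathZ normrZ ler_wpM2l// le_path_norm.
apply/eqP; rewrite eq_le le /=; have [->|a0] := eqVneq a 0.
  by rewrite normr0 mul0r; apply: le_trans (le_path_norm _ 0).
rewrite -ler_pdivlMl ?normr_gt0// -normfV -[X in path_norm X <= _](scalerK a0).
exact: le.
Qed.

Fact path_norm0 u : path_norm u = 0 -> u = 0.
Proof.
move=> u0; apply: cpathP => t _; apply/eqP; rewrite -normr_eq0 eq_le normr_ge0.
by rewrite andbT -u0 le_path_norm.
Qed.

HB.instance Definition _ := @Lmodule_isNormed.Build R cpath path_norm
  path_normD path_normZ path_norm0.

Lemma le_cpath_norm (u : cpath) t : `|u t| <= `|u|.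
Proof. exact: le_path_norm. Qed.

Lemma cpath_norm_le (u : cpath) M : (forall t, 0 <= t <= 1 -> `|u t| <= M) ->
  `|u| <= M.
Proof. exact: path_norm_le. Qed.

End PathSpace.

Section PathSpaceComplete.
Context {R : realType} (V : completeNormedModType R).

(** The Cauchy bound is uniform in t and survives the pointwise limit because closed balls are
    closed. The limit is thus uniform, hence continuous. *)
Lemma cpath_complete (F : set_system (cpath V)) :
  ProperFilter F -> cauchy F -> cvg F.
Proof.
move=> FF Fc.
have Fb e : 0 < e -> exists2 v : cpath V, True & \forall u \near F, `|v - u| < e.
  move=> e0; move/cauchy_ballP: Fc => /(_ _ e0)[[A B] /= [FA FB] AB].
  have [v Av] := filter_ex FA; exists v => //.
  by apply: filterS FB => u Bu; have := AB (v, u) (conj Av Bu); rewrite -ball_normE.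
have ptcvg t : cvg ((fun u : cpath V => u t) @ F).
  apply: cauchy_cvg; apply: cauchy_exP => e e0.
  have [v _ Hv] := Fb _ e0; exists (v t).
  apply: filterS Hv => u; rewrite -ball_normE /=; apply: le_lt_trans.
  by rewrite -cpathB; exact: le_cpath_norm.
pose f t := lim ((fun u : cpath V => u t) @ F).
have unif e : 0 < e -> F [set u : cpath V | forall t, `|f t - u t| <= e].
  move=> e0; have e2 : 0 < e / 2 by lra.
  have [v _ Hv] := Fb _ e2.
  have fv t : `|f t - v t| <= e / 2.
    have cl : closed [set x : V | `|x - v t| <= e / 2].
      have -> : [set x : V | `|x - v t| <= e / 2] = closed_ball_ Num.norm (v t) (e / 2).
        by apply/seteqP; split=> x; rewrite /closed_ball_ /= distrC.
      exact: closed_closed_ball_.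
    apply: (@closed_cvg _ _ _ FF (fun u : cpath V => u t) _ cl _ (f t)); last exact: ptcvg.
    apply: filterS Hv => u Hu; rewrite /= distrC -cpathB.
    by apply: le_trans (le_cpath_norm _ _) _; exact: ltW.
  apply: filterS Hv => u Hu t; apply: le_trans (ler_distD (v t) _ _) _.
  rewrite [leRHS]splitr lerD// -cpathB; apply: le_trans (le_cpath_norm _ _) _.
  exact: ltW.
have fP : f \in @path_pred R V.
  apply/path_predP; split; last first.
    apply/funext => t; rewrite /f /=; congr (lim (_ @ F)).
    by apply/funext => u; rewrite cpath_clamp.
  move=> t; apply/cvgrPdist_lt => e e0; have e3 : 0 < e / 3 by lra.
  have [u Hu] := filter_ex (unif _ e3).
  have /cvgrPdist_lt /(_ _ e3) := @cpath_continuous _ _ u t.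
  apply: filterS => s Hs; move: (Hu t) (Hu s); rewrite [`|f s - _|]distrC => H1 H2.
  have : `|f t - f s| <= `|f t - u t| + (`|u t - u s| + `|u s - f s|).
    apply: le_trans (ler_distD (u t) _ _) _; rewrite lerD2l; exact: ler_distD.
  by lra.
apply/cvg_ex; exists (CPath fP); apply/cvgrPdist_le => e e0.
by apply: filterS (unif _ e0) => u Hu; apply: cpath_norm_le => t _; exact: Hu.
Qed.
HB.instance Definition _ := Uniform_isComplete.Build (cpath V) cpath_complete.

End PathSpaceComplete.

HB.instance Definition _ (R : realType) m n := Complete.on 'M[R]_(m, n).

(** * Superposition operators *)

Lemma subDBr {Z : zmodType} (a b c d : Z) :
  a - (b + c) - (d - b) = a - d - c.
Proof.
have -> : a - (b + c) = a - b - c by rewrite opprD addrA.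
by rewrite opprB addrAC subrKA.
Qed.

Section RowNorm.
Context {R : realType} {m n : nat}.

Lemma mx_coord_le (A : 'M[R]_(m, n)) i j : `|A i j| <= `|A|.
Proof. by rewrite [leRHS]/Num.Def.normr /= mx_normrE (le_bigmax _ _ (i, j)). Qed.

Lemma mx_norm_le (A : 'M[R]_(m, n)) M : 0 <= M ->
  (forall i j, `|A i j| <= M) -> `|A| <= M.
Proof.
by move=> M0 AM; rewrite [leLHS]/Num.Def.normr /= mx_normrE bigmax_le// => -[].
Qed.

End RowNorm.

(** * Mean value inequality and strict differentiability *)

Section MeanValue.
Context {R : realType}.
Implicit Types V W : normedModType R.

Lemma is_derive_comp V W (g : V -> W) (c : R -> V) (s : R) (v : V) :
  is_derive s 1 c v -> differentiable g (c s) ->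
  is_derive s 1 (g \o c) ('d g (c s) v).
Proof.
move=> [dc cE] dg.
have dc' : differentiable c s by exact/derivable1_diffP.
have dgc : differentiable (g \o c) s by exact: differentiable_comp.
apply: DeriveDef; first exact/derivable1_diffP.
by rewrite deriveE// diff_comp//= -(deriveE _ dc') cE.
Qed.

Lemma is_derive_line V (x h : V) (s : R) :
  is_derive s 1 (fun s => x + s *: h) h.
Proof.
have dl : is_derive s 1 (fun s : R => s *: h) h.
  have ds : differentiable (fun s : R => s *: h) s by exact: ex_diff.
  apply: DeriveDef; first exact/derivable1_diffP.
  by rewrite deriveE// diff_val scale1r.
by apply: (is_derive_eq (is_deriveD _ _)); rewrite add0r.
Qed.

(** The scalar mean value theorem is applied to each coordinate; with the sup norm on row vectors no
    constant is lost. *)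
Lemma mean_value_rV V m (g : V -> 'rV[R]_m) (x h : V) (M : R) :
  (forall s, 0 <= s <= 1 -> differentiable g (x + s *: h) /\
     `|'d g (x + s *: h) h| <= M) ->
  `|g (x + h) - g x| <= M.
Proof.
move=> H; have M0 : 0 <= M.
  have [|_] := H 0; first by rewrite lexx ler01.
  exact: le_trans.
apply: mx_norm_le => // i j; rewrite !mxE (ord1 i).
pose c s := x + s *: h.
have D (s : R) : 0 <= s <= 1 ->
    is_derive s (1 : R) (fun s : R => g (c s) 0 j : R) ('d g (c s) h 0 j).
  move=> s01; have [dg _] := H _ s01.
  have [dgc gcE] := is_derive_comp (is_derive_line x h s) dg.
  apply: DeriveDef; first by move/derivable_mxP: dgc; apply.
  by have := derive_mx dgc; rewrite gcE => ->; rewrite mxE.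
have [|||c0 c01] := @MVT R (fun s => g (c s) 0 j) (fun s => 'd g (c s) h 0 j) 0 1.
- exact: ltr01.
- by move=> s; rewrite in_itv /= => /andP[s0 s1]; apply: D; rewrite (ltW s0) (ltW s1).
- apply: derivable_within_continuous => s; rewrite in_itv /= => s01.
  by have [] := D _ s01.
rewrite /c scale1r scale0r addr0 subr0 mulr1 => ->.
move: c01; rewrite in_itv /= => /andP[s0 s1].
by apply: le_trans (mx_coord_le _ _ _) _; have [|] := H c0; rewrite ?(ltW s0) ?(ltW s1).
Qed.

Lemma tang0 V W (g : V -> W) x : tang g (x, 0) = 0.
Proof. by rewrite /tang /= linear0. Qed.

Lemma tangZ V W (g : V -> W) x a w : tang g (x, a *: w) = a *: tang g (x, w).
Proof. by rewrite /tang /= linearZ. Qed.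

(* The tangent map is homogeneous in its second argument, so its mere
   differentiability at (x0, 0) already gives continuity of the differential
   in operator norm. *)
Lemma diff_norm_continuous V W (g : V -> W) x0 :
  differentiable (tang g) (x0, 0) -> forall e, 0 < e -> exists2 d, 0 < d &
    forall y w, `|y| < d ->
      `|tang g (x0 + y, w) - tang g (x0, w)| <= e * `|w|.
Proof.
move=> dtg e e0; have e3 : 0 < e / 3 by lra.
have [d d0 H] := differentiable_estimate dtg e3.
pose L := 'd (tang g) (x0, 0).
have {}H y w : `|y| < d -> `|w| < d ->
    `|tang g (x0 + y, w) - L (y, w)| <= e / 3 * Num.max `|y| `|w|.
  move=> yd wd; have := H (y, w); rewrite prod_normE /= gt_max yd wd => /(_ isT).
  rewrite tang0 subr0; congr (`|tang g _ - _| <= _).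
  by apply/pair_equal_spec; rewrite /= add0r.
exists (d / 2); first by lra.
move=> y w yd; have [->|w0] := eqVneq w 0.
  by rewrite !tang0 subrr !normr0 mulr0.
have nw0 : 0 < `|w| by rewrite normr_gt0.
pose s := d / (2 * `|w|).
have s0 : 0 < s by rewrite divr_gt0// mulr_gt0.
have sw : `|s *: w| = d / 2.
  by rewrite normrZ (gtr0_norm s0) /s invfM -!mulrA mulVf ?mulr1// gt_eqF.
clearbody s.
have yd' : `|y| < d by lra.
have swd : `|s *: w| < d by lra.
have z0 : `|0 : V| < d by rewrite normr0.
have mle : Num.max `|y| `|s *: w| = `|s *: w| by rewrite max_r// sw ltW.
have H1 := H _ _ yd' swd; rewrite mle in H1.
(* The tangent map vanishes at (x0 + y, 0), so the remainder there is [L (y, 0)] up to sign; this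
   bounds the part of L that depends on y. *)
have H2 := H _ _ yd' z0; rewrite tang0 sub0r normrN normr0 max_l// in H2.
have H3 := H _ _ z0 swd; rewrite normr0 max_r// addr0 in H3.
have LE : L (y, s *: w) = L (y, 0) + L (0, s *: w).
  rewrite -linearD; congr (L _).
  by apply/pair_equal_spec; rewrite /= addr0 add0r.
have : `|tang g (x0 + y, s *: w) - tang g (x0, s *: w)| <= e * `|s *: w|.
  have -> : tang g (x0 + y, s *: w) - tang g (x0, s *: w) =
      (tang g (x0 + y, s *: w) - L (y, s *: w)) + (L (y, 0) -
      (tang g (x0, s *: w) - L (0, s *: w))).
    by rewrite opprB [X in _ = _ + X]addrA -LE subrKA.
  have := ler_normD (tang g (x0 + y, s *: w) - L (y, s *: w)) (L (y, 0) -
      (tang g (x0, s *: w) - L (0, s *: w))).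
  have := ler_normB (L (y, 0)) (tang g (x0, s *: w) - L (0, s *: w)).
  have : e / 3 * `|y| <= e / 3 * `|s *: w| by rewrite ler_wpM2l// ?ltW// sw.
  set a := e / 3 * `|s *: w| in H1 H3 *.
  have -> : e * `|s *: w| = 3 * a by rewrite /a; field.
  by move: H1 H2 H3; lra.
by rewrite !tangZ -scalerBr !normrZ (gtr0_norm s0) mulrCA (ler_pM2l s0).
Qed.

Lemma differentiable_sub_linear V W (g : V -> W) (L : {linear V -> W}) x :
  continuous L -> differentiable g x ->
  differentiable (fun y => g y - L y) x /\
  forall v, 'd (fun y => g y - L y) x v = 'd g x v - L v.
Proof.
move=> Lc dg; have dL : differentiable L x by exact: linear_differentiable.
split=> [|v]; first exact: (@differentiableB _ _ _ g L).
apply: etrans (congr1 (@^~ v) (diffB dg dL)) _ => /=.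
by congr (_ - _); exact: (congr1 (@^~ v) (diff_lin x Lc)).
Qed.

(** The radius d is the same for all base points x near x0, as is needed to control the remainder
    along a whole path. The proof applies the mean value inequality to g minus its differential at
    x0, whose derivative is small near x0. *)
Lemma strictly_differentiable V m (U : set V) (g : V -> 'rV[R]_m) x0 :
  open U -> Tk 2 U g -> U x0 -> forall e, 0 < e -> exists2 d, 0 < d &
    forall x h, `|x - x0| < d -> `|h| < d ->
      U (x + h) /\ `|g (x + h) - g x - 'd g x h| <= e * `|h|.
Proof.
move=> oU [dg [dtg _]] Ux0 e e0; have e2 : 0 < e / 2 by lra.
have [d d0 Hd] := diff_norm_continuous (dtg (x0, 0) Ux0) e2.
have /nbhs_normP[d' /= d'0 Hd'] : \forall x \near x0, U x by exact: open_nbhs_nbhs.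
pose m0 := Num.min d d'.
have m00 : 0 < m0 by rewrite lt_min d0.
exists (m0 / 2); first by lra.
move=> x h xm hm.
have seg s : 0 <= s <= 1 -> U (x + s *: h) /\ `|x + s *: h - x0| < d.
  move=> /andP[s0 s1]; have : `|x + s *: h - x0| < m0.
    rewrite addrAC; apply: le_lt_trans (ler_normD _ _) _.
    rewrite normrZ (ger0_norm s0); have : s * `|h| <= `|h| by rewrite ler_piMl.
    lra.
  rewrite lt_min => /andP[H1 H2]; split=> //; apply: Hd'.
  by rewrite /= distrC.
have dB s : 0 <= s <= 1 ->
    `|tang g (x + s *: h, h) - tang g (x0, h)| <= e / 2 * `|h|.
  move=> s01; have [_ H] := seg _ s01; have := Hd _ h H.
  by rewrite [x0 + _]addrC subrK.
have s00 : (0 : R) <= 0 <= (1 : R) by rewrite lexx ler01.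
have s11 : (0 : R) <= (1 : R) <= (1 : R) by rewrite lexx ler01.
split; first by have [] := seg 1 s11; rewrite scale1r.
have L0c : continuous ('d g x0) by exact/diff_continuous/dg.
have : `|(g (x + h) - 'd g x0 (x + h)) - (g x - 'd g x0 x)| <= e / 2 * `|h|.
  apply: (@mean_value_rV V m (fun y => g y - 'd g x0 y)) => s s01.
  have [Us _] := seg _ s01.
  have [dsub ->] := differentiable_sub_linear L0c (dg _ Us).
  by split=> //; exact: dB.
have := dB 0 s00; rewrite scale0r addr0 /tang /= => H1 H2.
rewrite [e]splitr mulrDl -[X in `|X|](subrKA ('d g x0 h)).
apply: le_trans (ler_normD _ _) _; apply: lerD; last by rewrite distrC.
move: H2; congr (`|_| <= _); rewrite linearD /=.
exact: subDBr.
Qed.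

End MeanValue.

(** * Smoothness of u |-> g o u on the space of paths *)

Section Nemytskii.
Context {R : realType}.
Implicit Types V W : normedModType R.

(** Local radii become one radius valid on all of K. It is applied to the range of a path, so that
    pointwise estimates hold uniformly in time. *)
Lemma compact_uniform V (K : set V) (P : R -> V -> Prop) : compact K ->
  (forall d d' x, d' <= d -> P d x -> P d' x) ->
  (forall x0, K x0 -> exists2 d, 0 < d & forall x, `|x - x0| < d -> P d x) ->
  exists2 d, 0 < d & forall x, K x -> P d x.
Proof.
move=> /compact_near_coveringP cK Pmono Ploc.
have : \forall d \near 0^'+, K `<=` P d.
  apply: cK => x0 /Ploc[d d0 Hd].
  exists (ball x0 d, [set d' | d' < d]) => /=.
    by split; [exact: nbhsx_ballx|exact: nbhs_right_lt].
  move=> [x d'] /= []; rewrite -ball_normE /= distrC => xd d'd.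
  exact/(Pmono d)/Hd/xd/ltW.
move=> H; have /filter_ex[d [d0 Hd]] : \forall d \near (0 : R)^'+, 0 < d /\ K `<=` P d.
  by apply: filterI; [exact: nbhs_right_gt|exact: H].
by exists d.
Qed.

Lemma compose_path V W (g : V -> W) (u : cpath V) :
  (forall t, {for u t, continuous g}) -> (g \o u) \in @path_pred R W.
Proof.
move=> cg; apply/path_predP; split.
  by move=> t; apply: continuous_comp; [exact: cpath_continuous|exact: cg].
by apply/funext => t /=; rewrite cpath_clamp.
Qed.

(* The superposition operator u |-> g o u (0 when g o u is discontinuous). *)
Definition nem V W (g : V -> W) (u : cpath V) : cpath W := insubd 0 (g \o u).

Lemma nemE V W (g : V -> W) (u : cpath V) t :
  (forall t, {for u t, continuous g}) -> nem g u t = g (u t).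
Proof.
by move=> cg; rewrite /nem /insubd insubT //; exact: compose_path.
Qed.

Lemma path_pair V W (z : cpath V * cpath W) :
  (fun t => (z.1 t, z.2 t)) \in @path_pred R (V * W)%type.
Proof.
apply/path_predP; split; last by apply/funext => t /=; rewrite !cpath_clamp.
by move=> t; apply: cvg_pair; exact: cpath_continuous.
Qed.

(** A pair of paths as a path of pairs: through this linear map the tangent map of a superposition
    operator is again a superposition operator. *)
Definition cpair V W (z : cpath V * cpath W) : cpath (V * W)%type :=
  CPath (path_pair z).

Lemma Tk_cpair k V W (U : set (cpath V * cpath W)) : Tk k U (@cpair V W).
Proof.
have lin : linear (@cpair V W).
  by move=> a u v; apply: cpathP => t _; rewrite cpathD cpathZ.
apply: Tk_linear => //.
pose L : {linear (cpath V * cpath W)%type -> cpath (V * W)%type} :=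
  HB.pack (@cpair V W) (GRing.isLinear.Build _ _ _ _ (@cpair V W) lin).
apply: (@bounded_linear_continuous _ _ _ L); apply/linear_boundedP.
near=> r => z; apply: (@le_trans _ _ (1 * `|z|)).
  rewrite mul1r; apply: cpath_norm_le => t _.
  by rewrite !prod_normE /= ge_max !le_max !le_cpath_norm orbT.
by rewrite ler_wpM2r.
Unshelve. all: by end_near. Qed.

Definition paths_in V (U : set V) : set (cpath V) := [set u | forall t, U (u t)].

Lemma open_paths_in V (U : set V) : open U -> open (paths_in U).
Proof.
move=> oU; rewrite openE => u uU.
have [|x0 [t _ <-]|d d0 Hd] := @compact_uniform V (range u)
    (fun d x => forall h, `|h| < d -> U (x + h)) (@cpath_compact R V u).
- by move=> d d' x d'd H h hd; apply/H/(lt_le_trans hd).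
- have /nbhs_normP[d /= d0 Hd] : \forall x \near u t, U x.
    by apply: open_nbhs_nbhs; split=> //; exact: uU.
  exists (d / 2); first by lra.
  move=> x xd h hd; apply: Hd; rewrite /= opprD addrA -[u t - x]opprB.
  by apply: le_lt_trans (ler_normB _ _) _; rewrite normrN; lra.
apply/(@nbhs_normP R (cpath V)); exists d => // v /= uv t.
rewrite -(subrK (u t) (v t)) addrC; apply: Hd; first by exists t.
by rewrite distrC -cpathB; apply: le_lt_trans uv; exact: le_cpath_norm.
Qed.

(** Strict differentiability of g, made uniform over the compact range of u, bounds the remainder at
    each time by e |h t|, hence in the norm of paths by e |h|. *)
Lemma nem_differentiable V m (U : set V) (g : V -> 'rV[R]_m) (u : cpath V) :
  open U -> Tk 2 U g -> paths_in U u ->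
  differentiable (nem g) u /\
  forall w, 'd (nem g) u w = nem (tang g) (cpair (u, w)).
Proof.
move=> oU Tg uU; have [dg [dtg _]] := Tg.
have cg x : U x -> {for x, continuous g}.
  by move=> Ux; exact/differentiable_continuous/dg.
have nemtE w t : nem (tang g) (cpair (u, w)) t = tang g (u t, w t).
  rewrite nemE// => s; apply/differentiable_continuous/dtg; exact: uU.
(* The bound is written as the inverse of d so that the uniformity lemma, which produces small
   numbers, yields an upper bound: [C^-1] bounds the differentials of g along u. *)
have [|x0 [t _ <-]|C C0 HC] := @compact_uniform V (range u)
    (fun d x => 0 < d -> forall w, `|tang g (x, w)| <= d^-1 * `|w|) (@cpath_compact R V u).
- move=> d d' x d'd H d'0 w; have d0 := lt_le_trans d'0 d'd.
  by apply: le_trans (H d0 w) _; rewrite ler_wpM2r// lef_pV2.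
- have [d d0 Hd] := diff_norm_continuous (dtg (u t, 0) (uU t)) ltr01.
  have [C C0 HC] := differentiable_bound (dg _ (uU t)).
  have C10 : 0 < (C + 1)^-1 by rewrite invr_gt0 addr_gt0.
  exists (Num.min d (C + 1)^-1); first by rewrite lt_min d0.
  move=> x; rewrite lt_min => /andP[xd _] m0 w.
  have := Hd _ w xd; rewrite [u t + _]addrC subrK => H.
  apply: (@le_trans _ _ ((C + 1) * `|w|)).
    rewrite -(subrK (tang g (u t, w)) (tang g (x, w))).
    apply: le_trans (ler_normD _ _) _; rewrite mulrDl addrC lerD//.
    exact: HC.
  by rewrite ler_wpM2r// -[leLHS]invrK lef_pV2// ge_min lexx orbT.
suff [dn dnE] : differentiable (nem g) u /\
    'd (nem g) u = (fun w => nem (tang g) (cpair (u, w))) :> (_ -> _).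
  by split=> // w; rewrite dnE.
apply: (differentiable_of_estimate (C := C^-1)).
- move=> a v w; apply: cpathP => t _; rewrite cpathD cpathZ !nemtE.
  by rewrite cpathD cpathZ /tang /= linearP.
- move=> w; apply: cpath_norm_le => t _; rewrite nemtE.
  apply: le_trans (HC (u t) _ C0 (w t)) _; first by exists t.
  by rewrite ler_wpM2l ?le_cpath_norm// invr_ge0 ltW.
move=> e e0.
have [|x0 [t _ <-]|d d0 Hd] := @compact_uniform V (range u)
    (fun d x => forall h, `|h| < d -> U (x + h) /\
       `|g (x + h) - g x - 'd g x h| <= e * `|h|) (@cpath_compact R V u).
- by move=> d d' x d'd H h hd; apply/H/(lt_le_trans hd).
- have [d d0 Hd] := strictly_differentiable oU Tg (uU t) e0.
  by exists d => // x xd h hd; exact: Hd.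
exists d => // h hd.
have uhU t : U ((u + h) t).
  have [|//] := Hd (u t) (ex_intro2 _ _ t I erefl) (h t).
  by apply: le_lt_trans hd; exact: le_cpath_norm.
apply: cpath_norm_le => t _.
have E0 : nem g u t = g (u t) by apply: nemE => s; exact/cg/uU.
have E1 : nem g (u + h) t = g (u t + h t) by apply: nemE => s; exact/cg/uhU.
rewrite !cpathB E0 E1 (nemtE h t); have [|_ H] := Hd (u t) (ex_intro2 _ _ t I erefl) (h t).
  by apply: le_lt_trans hd; exact: le_cpath_norm.
by apply: le_trans H _; rewrite ler_wpM2l ?le_cpath_norm// ltW.
Qed.

(** The tangent map is [nem (tang g)] after [cpair], so the induction passes from g to [tang g].
    Each step costs one order of g, whence g is assumed to be of every class. *)
Lemma nem_Tk k V m (U : set V) (g : V -> 'rV[R]_m) : open U ->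
  (forall j, Tk j U g) -> Tk k (paths_in U) (nem g).
Proof.
elim: k V U g => [|k IH] V U g oU Tg.
  move=> u uU; apply: differentiable_continuous.
  by have [] := nem_differentiable oU (Tg 2) uU.
split=> [u uU|]; first by have [] := nem_differentiable oU (Tg 2) uU.
have oP := open_paths_in oU.
have oF := open_fst (W := cpath V) oP.
apply: (@Tk_ext R k _ _ _ (fun z => nem (tang g) (cpair z)) _ oF).
  move=> [u w] /= uU; rewrite /tang /=.
  by have [_ ->] := nem_differentiable oU (Tg 2) uU.
apply: (Tk_comp (U' := paths_in [set z : V * V | U z.1]) oF _ (Tk_cpair _ _)).
  by move=> [u w] /= uU t; exact: uU.
by apply: IH; [exact: open_fst|move=> j; have [] := Tg j.+1].
Qed.

End Nemytskii.

(** * Primitives of paths *)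

Section Primitive.
Context {R : realType} {n : nat}.
Local Notation E := (cpath 'rV[R]_n).
Implicit Types (u v w : E).

(** Derivatives are requested only in the open interval because the constant extension of a path
    generally has corners at 0 and 1. *)
Lemma cpath_mean_value w (M : R) :
  (forall t : R, 0 < t < 1 -> exists2 d, is_derive t 1 w d & `|d| <= M) ->
  forall t : R, 0 <= t <= 1 -> `|w t - w 0| <= M.
Proof.
move=> H t /andP[t0 t1].
have M0 : 0 <= M.
  have [|d _] := H 2^-1; first by lra.
  exact: le_trans.
have [->|tn0] := eqVneq t 0; first by rewrite subrr normr0.
have {}t0 : 0 < t by rewrite lt_neqAle eq_sym tn0.
apply: mx_norm_le => // i j; rewrite !mxE (ord1 i).
have /choice[dw Hdw] : forall s : R, exists d : 'rV[R]_n,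
    0 < s < 1 -> is_derive s 1 w d /\ `|d| <= M.
  move=> s; have [/H[d H1 H2]|_] := boolP (0 < s < 1); first by exists d.
  by exists 0.
have [||c c01] := @MVT R (fun s => w s 0 j) (fun s => dw s 0 j) 0 t t0.
- move=> s; rewrite in_itv /= => /andP[s0 st].
  have [|[dws dwE] _] := Hdw s; first by rewrite s0 (lt_le_trans st).
  apply: DeriveDef; first by move/derivable_mxP: dws; apply.
  by have := derive_mx dws; rewrite dwE => ->; rewrite mxE.
- apply: continuous_subspaceT => s.
  apply: (@continuous_comp _ _ _ w (fun x : 'rV[R]_n => x 0 j)).
    exact: cpath_continuous.
  exact: coord_continuous.
rewrite subr0 => ->; move: c01; rewrite in_itv /= => /andP[c0 ct].
rewrite normrM (gtr0_norm t0); have [|_ dM] := Hdw c.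
  by rewrite c0 (lt_le_trans ct).
apply: (@le_trans _ _ (M * 1)); last by rewrite mulr1.
apply: ler_pM => //; [exact: ltW|exact: le_trans (mx_coord_le _ _ _) dM].
Qed.

Lemma cpath_derive_unique u v : u 0 = v 0 ->
  (forall t : R, 0 < t < 1 -> exists2 d, is_derive t 1 u d & is_derive t 1 v d) ->
  u = v.
Proof.
move=> uv0 H; apply: cpathP => t t01; apply/eqP.
rewrite -subr_eq0 -normr_le0 -[u t - v t]subr0 -[X in _ - X](subrr (u 0)).
rewrite {2}uv0 -!cpathB.
apply: (@cpath_mean_value (u - v) 0) => // s /H[d du dv].
by exists (d - d); [exact: is_deriveB|rewrite subrr normr0].
Qed.

(** Integration starts at -1 so that the fundamental theorem gives a two-sided derivative at every
    point of [0, 1], including 0. The subtracted integral normalizes the value at 0. *)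
Definition prim_fun u (t : R) : 'rV[R]_n :=
  \row_j (\int[lebesgue_measure]_(s in `[-1, t]) u s 0 j
          - \int[lebesgue_measure]_(s in `[-1, 0]) u s 0 j).

Lemma prim_fun_derive u (t : R) : -1 < t -> is_derive t 1 (prim_fun u) (u t).
Proof.
move=> t1.
have cu j : continuous (fun s => u s 0 j).
  move=> s; apply: (@continuous_comp _ _ _ u (fun x : 'rV[R]_n => x 0 j)).
    exact: cpath_continuous.
  exact: coord_continuous.
have D j : is_derive t (1 : R) (fun t => prim_fun u t 0 j : R) (u t 0 j).
  have tt1 : t < t + 1 by lra.
  have iu : lebesgue_measure.-integrable
      [set` Interval (BLeft (-1)) (BRight (t + 1))] (EFin \o (fun s => u s 0 j)).
    apply: continuous_compact_integrable; first exact: segment_compact.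
    exact: continuous_subspaceT.
  have bt : (BLeft (-1)%R < BRight t)%E by rewrite /= lte_fin.
  have /= [dF FE] := continuous_FTC1 tt1 iu bt (cu j t).
  have -> : (fun t => prim_fun u t 0 j) = (fun t : R =>
    \int[lebesgue_measure]_(s in `[-1, t]) u s 0 j +
    cst (- \int[lebesgue_measure]_(s in `[-1, 0]) u s 0 j) t).
    by apply/funext => s; rewrite /prim_fun mxE.
  have Fd : is_derive t (1 : R) (fun t => \int[lebesgue_measure]_(s in `[-1, t]) u s 0 j) (u t 0 j).
    by apply: DeriveDef; [exact: dF|rewrite -derive1E; exact: FE].
  by apply: (is_derive_eq (is_deriveD Fd _)); rewrite addr0.
have dF : derivable (prim_fun u) t 1.
  by apply/derivable_mxP => i j; rewrite (ord1 i); have [] := D j.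
apply: DeriveDef => //; rewrite derive_mx//; apply/rowP => j.
by rewrite mxE; have [] := D j.
Qed.

Lemma prim_path u : (prim_fun u \o clamp01) \in @path_pred R 'rV[R]_n.
Proof.
apply/path_predP; split; last by apply/funext => t /=; rewrite clamp01K.
move=> t; apply: continuous_comp; first exact: clamp01_continuous.
apply: differentiable_continuous; apply/derivable1_diffP.
have /= := @clamp01_itv R t; rewrite in_itv /= => /andP[c0 _].
by have [] := @prim_fun_derive u (clamp01 t) (lt_le_trans (ltrN10 R) c0).
Qed.

Definition prim u : E := CPath (prim_path u).

Lemma prim0 u : prim u 0 = 0.
Proof.
rewrite /= clamp01_id ?lexx ?ler01//; apply/rowP => j.
by rewrite !mxE subrr.
Qed.

Lemma prim_derive u (t : R) : 0 < t < 1 -> is_derive t 1 (prim u) (u t).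
Proof.
move=> /andP[t0 t1].
apply: (@near_eq_is_derive _ _ _ (prim_fun u)); last first.
  by apply: prim_fun_derive; lra.
apply/nbhs_normP; exists (Num.min t (1 - t)).
  by rewrite /= lt_min t0 subr_gt0.
move=> s /=; rewrite lt_min ltr_norml !ltr_norml => /andP[/andP[s0 s1] /andP[s2 s3]].
by rewrite clamp01_id//; apply/andP; split; lra.
Qed.

Lemma prim_linear : linear prim.
Proof.
move=> a u v; apply: cpath_derive_unique.
  by rewrite cpathD cpathZ !prim0 scaler0 addr0.
move=> t t01; exists ((a *: u + v) t); first exact: prim_derive.
rewrite cpathD cpathZ.
have := prim_derive u t01; have := prim_derive v t01 => dv du.
have dZ : is_derive t 1 (a *: (prim u : R -> _)) (a *: u t) by exact: is_deriveZ.
exact: (is_deriveD dZ dv).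
Qed.

Lemma le_prim u : `|prim u| <= `|u|.
Proof.
apply: cpath_norm_le => t t01; rewrite -[prim u t]subr0 -(prim0 u).
apply: cpath_mean_value t t01 => s s01; exists (u s); first exact: prim_derive.
exact: le_cpath_norm.
Qed.

Lemma Tk_prim k (U : set E) : Tk k U prim.
Proof.
apply: Tk_linear; first exact: prim_linear.
pose L : {linear E -> E} := HB.pack prim (GRing.isLinear.Build _ _ _ _ prim prim_linear).
apply: (@bounded_linear_continuous _ _ _ L); apply/linear_boundedP.
near=> r => u; apply: (@le_trans _ _ (1 * `|u|)); first by rewrite mul1r le_prim.
by rewrite ler_wpM2r.
Unshelve. all: by end_near. Qed.

Lemma cst_path (x : 'rV[R]_n) : cst x \in @path_pred R 'rV[R]_n.
Proof. by apply/path_predP; split=> //; exact: cst_continuous. Qed.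

Definition cpath_cst x : E := CPath (cst_path x).

Lemma Tk_cpath_cst k (U : set 'rV[R]_n) : Tk k U cpath_cst.
Proof.
have lin : linear cpath_cst.
  by move=> a x y; apply: cpathP => t _; rewrite cpathD cpathZ.
apply: Tk_linear => //.
pose L : {linear 'rV[R]_n -> E} :=
  HB.pack cpath_cst (GRing.isLinear.Build _ _ _ _ cpath_cst lin).
apply: (@bounded_linear_continuous _ _ _ L); apply/linear_boundedP.
near=> r => x; apply: (@le_trans _ _ (1 * `|x|)).
  by rewrite mul1r; apply: cpath_norm_le.
by rewrite ler_wpM2r.
Unshelve. all: by end_near. Qed.

Lemma Tk_eval k t (U : set E) : Tk k U (fun u => u t).
Proof.
have lin : linear (fun u : E => u t) by move=> a x y; rewrite cpathD cpathZ.
apply: Tk_linear => //.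
pose L : {linear E -> 'rV[R]_n} :=
  HB.pack (fun u : E => u t) (GRing.isLinear.Build _ _ _ _ (fun u : E => u t) lin).
apply: (@bounded_linear_continuous _ _ _ L); apply/linear_boundedP.
near=> r => x; apply: (@le_trans _ _ (1 * `|x|)).
  by rewrite mul1r; exact: le_cpath_norm.
by rewrite ler_wpM2r.
Unshelve. all: by end_near. Qed.

End Primitive.

HB.instance Definition _ (R : realType) n :=
  GRing.isLinear.Build R (cpath 'rV[R]_n) (cpath 'rV[R]_n) _ (@prim R n) prim_linear.

(** * Differentiation rules and local Lipschitz bounds *)

Section DiffRules.
Context {R : realType}.
Implicit Types V W : normedModType R.

Lemma diff_sumE V W (I : Type) (s : seq I) (f : I -> V -> W) x :
  (forall i, differentiable (f i) x) ->
  differentiable (fun q => \sum_(i <- s) f i q) x /\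
  forall v, 'd (fun q => \sum_(i <- s) f i q) x v = \sum_(i <- s) 'd (f i) x v.
Proof.
move=> df; elim: s => [|i s [dS SE]].
  have -> : (fun q => \sum_(i <- [::]) f i q) = cst 0.
    by apply/funext => q; rewrite big_nil.
  by split=> [|v]; [exact: differentiable_cst|rewrite diff_cst big_nil].
have -> : (fun q => \sum_(j <- i :: s) f j q) =
    f i + (fun q => \sum_(j <- s) f j q).
  by apply/funext => q; rewrite big_cons.
split=> [|v]; first exact: differentiableD.
apply: etrans (congr1 (@^~ v) (diffD (df i) dS)) _ => /=.
by rewrite big_cons; congr (_ + _); exact: SE.
Qed.

Lemma diff_compE V V' W (f : V -> V') (g : V' -> W) x :
  differentiable f x -> differentiable g (f x) ->
  differentiable (fun q => g (f q)) x /\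
  forall v, 'd (fun q => g (f q)) x v = 'd g (f x) ('d f x v).
Proof.
move=> df dg; split=> [|v]; first exact: (@differentiable_comp _ _ _ _ f g).
by have /= -> := @diff_comp _ _ _ _ f g x df dg.
Qed.

Lemma diff_linear_comp V W W' (L : {linear W -> W'}) (f : V -> W) x :
  continuous L -> differentiable f x ->
  differentiable (fun q => L (f q)) x /\
  forall v, 'd (fun q => L (f q)) x v = L ('d f x v).
Proof.
move=> Lc df; have dL : differentiable L (f x) by exact: linear_differentiable.
have [dLf dLfE] := diff_compE df dL.
by split=> // v; rewrite dLfE diff_lin.
Qed.

Lemma diff_scaleE V W (k : V -> R^o) (f : V -> W) x :
  differentiable k x -> differentiable f x ->
  differentiable (fun p => k p *: f p) x /\
  forall v, 'd (fun p => k p *: f p) x v = k x *: 'd f x v + 'd k x v *: f x.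
Proof.
move=> dk df; pose b := @GRing.scale R W : R^o -> W -> W.
have sc : continuous (fun q : R^o * W => b q.1 q.2) by exact: scale_continuous.
have dp : differentiable (fun p => (k p, f p)) x by exact: differentiable_pair.
have db : differentiable (fun q : R^o * W => b q.1 q.2) (k x, f x).
  exact: (@differentiable_bilin _ _ _ _ (@GRing.scale R W : R^o -> W -> W)).
split=> [|v].
  exact: (@differentiable_comp _ _ _ _ (fun p => (k p, f p)) (fun q => b q.1 q.2)).
have /= -> := @diff_comp _ _ _ _ (fun p => (k p, f p)) (fun q => b q.1 q.2) x dp db.
by rewrite diff_pair//= (@diff_bilin _ _ _ _ (@GRing.scale R W : R^o -> W -> W)).
Qed.

Lemma is_derive_scale W (k : R -> R^o) (f : R -> W) (t : R) (k' : R^o) (f' : W) :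
  is_derive t 1 k k' -> is_derive t 1 f f' ->
  is_derive t 1 (fun s => k s *: f s) (k t *: f' + k' *: f t).
Proof.
move=> [dk kE] [df fE].
have dk' : differentiable k t by exact/derivable1_diffP.
have df' : differentiable f t by exact/derivable1_diffP.
have [d dE] := diff_scaleE dk' df'.
apply: DeriveDef; first exact/derivable1_diffP.
by rewrite deriveE// dE -!deriveE// kE fE.
Qed.

Lemma continuous_prim n : continuous (@prim R n).
Proof. by move=> u; have /(_ u I) := @Tk_prim R n 0 setT. Qed.

(** One number d is both the radius and the inverse of every bound. The statement holds for all
    small d, so finitely many fields can share the same d by intersecting filters. *)
Lemma locally_bounded_lipschitz V m (U : set V) (g : V -> 'rV[R]_m) p :
  open U -> Tk 2 U g -> U p -> \forall d \near 0^'+,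
    forall y, `|y - p| < d -> [/\ U y, `|g y| <= d^-1,
      forall w, `|tang g (y, w)| <= d^-1 * `|w| &
      forall y', `|y' - p| < d -> `|g y - g y'| <= d^-1 * `|y - y'|].
Proof.
move=> oU [dg [dtg _]] Up.
have [d d0 Hd] := diff_norm_continuous (dtg (p, 0) Up) ltr01.
have [C C0 HC] := differentiable_bound (dg _ Up).
have /nbhs_normP[d' /= d'0 Hd'] : \forall y \near p, U y by exact: open_nbhs_nbhs.
have /cvgrPdist_lt /(_ _ ltr01) /nbhs_normP[d2 /= d20 Hd2] :=
  differentiable_continuous (dg _ Up).
pose B := C + 1 + `|g p|.
have B0 : 0 < B by rewrite /B ltr_wpDr// addr_gt0.
near=> e.
have e0 : 0 < e by near: e; exact: nbhs_right_gt.
have ed : e < d by near: e; exact: nbhs_right_lt.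
have ed' : e < d' by near: e; exact: nbhs_right_lt.
have ed2 : e < d2 by near: e; exact: nbhs_right_lt.
have eB : B <= e^-1.
  rewrite -[B]invrK lef_pV2 ?posrE ?invr_gt0//; apply/ltW.
  by near: e; apply: nbhs_right_lt; rewrite invr_gt0.
have tB y w : `|y - p| < e -> `|tang g (y, w)| <= e^-1 * `|w|.
  move=> ye; apply: (@le_trans _ _ ((C + 1) * `|w|)).
    rewrite -(subrK (tang g (p, w)) (tang g (y, w))).
    apply: le_trans (ler_normD _ _) _; rewrite mulrDl addrC lerD//; first exact: HC.
    have := Hd (y - p) w (lt_trans ye ed).
    by rewrite [p + _]addrC subrK.
  rewrite ler_wpM2r//; apply: le_trans eB; rewrite /B lerDl//.
have UB y : `|y - p| < e -> U y.
  by move=> ye; apply: Hd'; rewrite /= distrC (lt_trans ye).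
move=> y ye; split.
- exact: UB.
- apply: le_trans eB; have : `|g p - g y| < 1.
    by apply: Hd2; rewrite /= distrC (lt_trans ye).
  have : `|g y| <= `|g p| + `|g p - g y|.
    by rewrite -[X in `|X| <= _](subKr (g p)) ler_normB.
  by rewrite /B; lra.
- by move=> w; exact: tB.
move=> y' ye'; rewrite distrC [`|y - y'|]distrC.
have := @mean_value_rV R V m g y (y' - y) (e^-1 * `|y' - y|).
rewrite [y + _]addrC subrK; apply => s /andP[s0 s1].
have H : `|y + s *: (y' - y) - p| < e.
  have -> : y + s *: (y' - y) - p = (1 - s) *: (y - p) + s *: (y' - p).
    rewrite scalerBl scale1r -[in RHS]addrA [X in _ = _ + X]addrC -scalerBr opprB.
    by rewrite [y' - p + _]addrA subrK addrAC.
  apply: le_lt_trans (ler_normD _ _) _.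
  rewrite !normrZ (ger0_norm s0) (@ger0_norm _ (1 - s)) ?subr_ge0//.
  have : s * `|y' - p| <= s * (Num.max `|y - p| `|y' - p|).
    by rewrite ler_wpM2l// le_max lexx orbT.
  have : (1 - s) * `|y - p| <= (1 - s) * (Num.max `|y - p| `|y' - p|).
    by rewrite ler_wpM2l ?subr_ge0// le_max lexx.
  have : Num.max `|y - p| `|y' - p| < e by rewrite gt_max ye.
  by rewrite mulrBl mul1r; lra.
by split; [exact/dg/UB|exact: tB].
Unshelve. all: by end_near. Qed.

End DiffRules.

(** * First integrals of a commuting frame *)

Section FirstIntegrals.
Context {R : realType} {n r : nat}.
Variables (U : set 'rV[R]_n) (p : 'rV[R]_n) (Y : 'I_r -> vector_field R n).
Variable A : 'M[R]_(n, r).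
Hypotheses (oU : open U) (Up : U p).
Hypothesis YT : forall i k, Tk k U (Y i).
Hypothesis YA : forall i q, U q -> Y i q *m A = delta_mx 0 i.
Hypothesis Ycomm : forall i j q, U q -> 'd (Y i) q (Y j q) = 'd (Y j) q (Y i q).

Local Notation E := (cpath 'rV[R]_n).

Definition transv (i : 'I_r) (q : 'rV[R]_n) : R^o := ((q - p) *m A) 0 i.

Lemma transv_diff i q : differentiable (transv i) q /\
  forall v, 'd (transv i) q v = (v *m A) 0 i.
Proof.
suff [dx xE] : differentiable (transv i) q /\
    'd (transv i) q = (fun v => (v *m A) 0 i) :> ('rV[R]_n -> R^o).
  by split=> // v; rewrite xE.
apply: (differentiable_of_estimate (C := \sum_j `|A j i|)).
- by move=> a u v; rewrite mulmxDl -scalemxAl !mxE.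
- move=> h; rewrite mxE; apply: le_trans (ler_norm_sum _ _ _) _.
  rewrite mulr_suml; apply: ler_sum => j _; rewrite normrM mulrC.
  by rewrite ler_wpM2l// mx_coord_le.
move=> e e0; exists 1 => // h _; rewrite /transv.
have -> : ((q + h - p) *m A) 0 i = ((q - p) *m A) 0 i + (h *m A) 0 i.
  by rewrite addrAC mulmxDl mxE.
by rewrite [X in X - _ - _]addrC addrK subrr normr0 mulr_ge0// ltW.
Qed.

Lemma Tk_transv k i (V : set 'rV[R]_n) : open V -> Tk k V (transv i).
Proof.
move=> oV.
apply: (@Tk_ext R k _ R^o V (fun q => \sum_j (q - p) 0 j *: A j i : R^o) _ oV).
  by move=> q _; rewrite /transv mxE.
apply: Tk_sum => // j; apply: Tk_scale => //; last exact: Tk_cst.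
by apply: Tk_coord => //; apply: TkB => //; [exact: Tk_id|exact: Tk_cst].
Qed.

Lemma transv_p i : transv i p = 0.
Proof. by rewrite /transv subrr mul0mx mxE. Qed.

Definition speed (q : 'rV[R]_n) (u : E) : E := \sum_i transv i q *: nem (Y i) u.

(* The curve [u] is fixed by [flow_map (q, -)] iff u(0) = q and
   u' = - \sum_i x_i(q) Y_i(u) on [0, 1], where x(q) = (q - p) A. *)
Definition flow_map (z : 'rV[R]_n * E) : E := cpath_cst z.1 - prim (speed z.1 z.2).

Lemma cpathE_sum (I : Type) (s : seq I) (f : I -> E) t :
  (\sum_(i <- s) f i) t = \sum_(i <- s) f i t.
Proof. by elim/big_rec2: _ => // i x y _ <-. Qed.

Lemma Ycont i (u : E) : paths_in U u -> forall t, {for u t, continuous (Y i)}.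
Proof. by move=> uU t; apply/differentiable_continuous; have [H _] := YT i 1; exact/H/uU. Qed.

Lemma tYcont i (u w : E) : paths_in U u ->
  forall t, {for cpair (u, w) t, continuous (tang (Y i))}.
Proof.
move=> uU t; apply/differentiable_continuous.
by have [_ [H _]] := YT i 2; apply: H; exact: uU.
Qed.

(** The derivative of q |-> [speed q (phi q)] along v, with w in place of 'd phi q v: one term from
    the moving path, one from the coefficients x_i(q). *)
Definition dspeed (q v : 'rV[R]_n) (u w : E) : E :=
  \sum_i (transv i q *: nem (tang (Y i)) (cpair (u, w)) + (v *m A) 0 i *: nem (Y i) u).

Lemma flow_equation_diff (W : set 'rV[R]_n) (phi : 'rV[R]_n -> E) q v : open W ->
  (forall q, W q -> paths_in U (phi q)) ->
  (forall q, W q -> phi q = flow_map (q, phi q)) -> Tk 1 W phi -> W q ->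
  'd phi q v = cpath_cst v - prim (dspeed q v (phi q) ('d phi q v)).
Proof.
move=> oW phiU phiE [dphi _] Wq; have dp := dphi _ Wq.
have nd i := nem_differentiable oU (YT i 2) (phiU _ Wq).
have cdd i := diff_compE dp (nd i).1.
have cd i : differentiable (fun q => nem (Y i) (phi q)) q := (cdd i).1.
have cdE i w : 'd (fun q => nem (Y i) (phi q)) q w =
    nem (tang (Y i)) (cpair (phi q, 'd phi q w)).
  exact: etrans ((cdd i).2 w) ((nd i).2 _).
have sd i := diff_scaleE (transv_diff i q).1 (cd i).
have [Sd SdE] := @diff_sumE R _ _ _ (index_enum 'I_r)
  (fun i q => transv i q *: nem (Y i) (phi q)) q (fun i => (sd i).1).
have [Pd PdE] := diff_linear_comp (@continuous_prim R n) Sd.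
have Kd : differentiable (@cpath_cst R n) q by have [H _] := @Tk_cpath_cst R n 1 setT; exact: H.
have KdE w : 'd (@cpath_cst R n) q w = cpath_cst w.
  have lin : linear (@cpath_cst R n).
    by move=> a x y; apply: cpathP => t _; rewrite cpathD cpathZ.
  pose L : {linear 'rV[R]_n -> E} :=
    HB.pack (@cpath_cst R n) (GRing.isLinear.Build _ _ _ _ (@cpath_cst R n) lin).
  have Lc : continuous L by move=> x; have /(_ x I) := @Tk_cpath_cst R n 0 setT.
  by rewrite -[@cpath_cst R n]/(L : _ -> _) diff_lin.
have near_phi : {near q, (@cpath_cst R n - (fun q => prim (speed q (phi q)))) =1 phi}.
  apply: filterS (open_nbhs_nbhs (conj oW Wq)) => q' Wq'.
  by rewrite [RHS]phiE.
have [_ phiE'] := near_eq_differentiable near_phi (differentiableB Kd Pd).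
rewrite {1}phiE'; apply: etrans (congr1 (@^~ v) (diffB Kd Pd)) _.
apply: etrans (congr2 (fun a b => a - b) (KdE v) (PdE v)) _.
congr (_ - prim _); apply: etrans (SdE v) _.
apply: eq_bigr => i _; apply: etrans ((sd i).2 v) _.
by congr (_ *: _ + _ *: _); [exact: cdE|exact: (transv_diff i q).2].
Qed.

Lemma flow_start q u : u = flow_map (q, u) -> u 0 = q.
Proof.
by move=> {1}->; rewrite /flow_map cpathB prim0 subr0.
Qed.

Lemma cst_prim_derive x (G : E) (t : R) : 0 < t < 1 ->
  is_derive t 1 (cpath_cst x - prim G) (- G t).
Proof.
move=> t01; have dp := prim_derive G t01.
have dc : is_derive t 1 (cpath_cst x) 0 by exact: is_derive_cst.
by rewrite -[- G t]add0r; exact: (is_deriveB dc dp).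
Qed.

Lemma shrink_path (f : E) : (fun t => (1 - clamp01 t) *: f t) \in @path_pred R 'rV[R]_n.
Proof.
apply/path_predP; split.
  move=> t; apply: (@cvgZ _ _ _ _ _ (fun t : R => 1 - clamp01 t)).
    by apply: cvgB; [exact: cvg_cst|exact: clamp01_continuous].
  exact: cpath_continuous.
by apply/funext => t /=; rewrite clamp01K cpath_clamp.
Qed.

(* Commutation of the Y_i is what makes (1 - t) Y_j(u(t)) a solution of the
   linearized flow equation with initial value Y_j(q). *)
Lemma linearized_solution q u j : paths_in U u -> u = flow_map (q, u) ->
  let w := CPath (shrink_path (nem (Y j) u)) in
  w = cpath_cst (Y j q) - prim (dspeed q (Y j q) u w).
Proof.
move=> uU uE w.
have wE t : 0 <= t <= 1 -> w t = (1 - t) *: Y j (u t).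
  by move=> t01; rewrite /w /= clamp01_id// nemE//; exact: Ycont.
have Uq : U q by rewrite -(flow_start uE); exact: uU.
apply: cpath_derive_unique.
  by rewrite wE ?lexx ?ler01// cpathB prim0 !subr0 scale1r (flow_start uE).
move=> t t01; exists (- dspeed q (Y j q) u w t); last exact: cst_prim_derive.
have t01' : 0 <= t <= 1 by case/andP: t01 => *; rewrite !ltW.
have du : is_derive t 1 u (- speed q u t).
  by rewrite {1}uE; exact: cst_prim_derive.
have dYj : differentiable (Y j) (u t) by have [H _] := YT j 1; exact/H/uU.
have := is_derive_comp du dYj => dYu.
have dl : is_derive t 1 (fun t : R => 1 - t : R^o) (-1).
  by apply: (is_derive_eq (is_deriveB _ _)); rewrite sub0r.
have := is_derive_scale dl dYu; rewrite /= scaleN1r.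
set D := 'd (Y j) (u t) _ => dw.
have wE' : - dspeed q (Y j q) u w t =
    (1 - t) *: D - Y j (u t).
  have E1 : D =
      - \sum_i transv i q *: 'd (Y j) (u t) (Y i (u t)).
    rewrite /D linearN; congr (- _); rewrite /speed cpathE_sum linear_sum.
    apply: eq_bigr => i _; rewrite cpathZ nemE; last exact: Ycont.
    exact: linearZ.
  have E2 : dspeed q (Y j q) u w t =
      \sum_i transv i q *: ((1 - t) *: 'd (Y i) (u t) (Y j (u t))) + Y j (u t).
    (* The coefficients x_i, differentiated along Y_j(q), give the entries of Y_j(q) A, a unit
       vector; their term therefore reduces to Y_j(u). *)
    have YjE : Y j (u t) = \sum_i (Y j q *m A) 0 i *: Y i (u t).
      rewrite (bigD1 j)//= YA// mxE !eqxx scale1r big1 ?addr0// => i ij.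
      by rewrite mxE eqxx (negbTE ij) scale0r.
    rewrite [X in _ = _ + X]YjE -big_split /dspeed cpathE_sum; apply: eq_bigr => i _.
    rewrite cpathD !cpathZ nemE; last exact: tYcont.
    rewrite nemE; last exact: Ycont.
    congr (_ *: _ + _); rewrite -[cpair _ t]/(u t, w t) wE//.
    exact: tangZ.
  rewrite E1 E2 opprD scalerN scaler_sumr; congr (- _ - _).
  apply: eq_bigr => i _; have C := Ycomm i j (uU t).
  rewrite scalerA [_ * _]mulrC -scalerA; congr (_ *: (_ *: _)); exact: C.
rewrite wE'; apply: near_eq_is_derive dw.
have /andP[t0 t1] := t01.
apply/nbhs_normP; exists (Num.min t (1 - t)).
  by rewrite /= lt_min t0 subr_gt0.
move=> s /=; rewrite lt_min !ltr_norml => /andP[/andP[s0 s1] /andP[s2 s3]].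
by apply/esym/wE; apply/andP; split; lra.
Qed.

Lemma diff_eval (phi : 'rV[R]_n -> E) q t v : differentiable phi q ->
  'd (fun q => phi q t) q v = 'd phi q v t.
Proof.
move=> dphi; have lin : linear (fun u : E => u t).
  by move=> a x y; rewrite cpathD cpathZ.
pose L : {linear E -> 'rV[R]_n} :=
  HB.pack (fun u : E => u t) (GRing.isLinear.Build _ _ _ _ (fun u : E => u t) lin).
have Lc : continuous L by move=> x; have /(_ x I) := @Tk_eval R n 0 t setT.
exact: (diff_linear_comp Lc dphi).2.
Qed.

Lemma first_integrals : exists (W : set 'rV[R]_n) (H : 'rV[R]_n -> 'rV[R]_n),
  [/\ open W /\ W p, W `<=` U, (forall k, Tk k W H),
      (forall q i, W q -> 'd H q (Y i q) = 0) &
      (forall v, v *m A = 0 -> 'd H p v = v)].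
Proof.
have Hnear : \forall d \near (0 : R)^'+, forall i y, `|y - p| < d ->
    [/\ U y, `|Y i y| <= d^-1,
      forall w, `|tang (Y i) (y, w)| <= d^-1 * `|w| &
      forall y', `|y' - p| < d -> `|Y i y - Y i y'| <= d^-1 * `|y - y'|].
  by apply: filter_forall => i; exact: locally_bounded_lipschitz.
have [dU dU0 HdU] : exists2 d, 0 < d & forall y, `|y - p| < d -> U y.
  have /nbhs_normP[d d0 Hd] : \forall y \near p, U y by exact: open_nbhs_nbhs.
  by exists d => // y yd; apply: Hd; rewrite /= distrC.
have /filter_ex[d [[d0 ddU] Hd]] : \forall d \near (0 : R)^'+, (0 < d /\ d < dU) /\
    forall i y, `|y - p| < d -> [/\ U y, `|Y i y| <= d^-1,
      forall w, `|tang (Y i) (y, w)| <= d^-1 * `|w| &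
      forall y', `|y' - p| < d -> `|Y i y - Y i y'| <= d^-1 * `|y - y'|].
  apply: filterI Hnear; apply: filterI; first exact: nbhs_right_gt.
  exact: nbhs_right_lt.
(* The fields are bounded and Lipschitz with constant 1/d. Coefficients of total size below d/2 make
   the map a 1/2-contraction, and below d * d / 4 they keep the displacement at most d/4. *)
pose eta := Num.min (d / 2) (d * d / 4).
have eta0 : 0 < eta.
  by rewrite lt_min; apply/andP; split; [lra|rewrite divr_gt0// mulr_gt0].
have /nbhs_normP[e /= e0 He] : \forall q \near p,
    `|p - q| < d / 4 /\ \sum_i `|transv i q| < eta.
  apply: filterI.
    have d4 : 0 < d / 4 by lra.
    by apply: filterS (nbhsx_ballx p _ d4) => q; rewrite -ball_normE.
  (* The denominator r + 1 is positive even for r = 0 and makes the sum of r such bounds strictly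
     smaller than eta. *)
  pose c := eta / (r%:R + 1).
  have c0 : 0 < c by rewrite divr_gt0// ltr_wpDl.
  have : \forall q \near p, forall i, `|transv i q| <= c.
    apply: (@filter_forall _ _ _ _ (nbhs_filter p)) => i.
    have cx : {for p, continuous (transv i)}.
      exact: differentiable_continuous (transv_diff i p).1.
    move/cvgrPdist_le: cx => /(_ _ c0).
    by apply: filterS => q; rewrite transv_p sub0r normrN.
  apply: filterS => q Hq; apply: (@le_lt_trans _ _ (\sum_(i < r) c)).
    by apply: ler_sum => i _; exact: Hq.
  rewrite sumr_const card_ord -mulr_natr /c -mulrA gtr_pMr//.
  by rewrite mulrC ltr_pdivrMr ?mul1r ?ltrDl// ltr_wpDl.
pose W := ball p e; pose O := [set u : E | `|u - cpath_cst p| < d].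
have Wp : W p by exact: ballxx.
have oW : open W by exact: ball_open.
have WE q : W q -> `|q - p| < d / 4 /\ \sum_i `|transv i q| < eta.
  by rewrite /W -ball_normE => /He []; rewrite distrC.
have oO : open O.
  rewrite (_ : O = ball (cpath_cst p) d); first exact: ball_open.
  by apply/seteqP; split=> u; rewrite -ball_normE /O /= distrC.
have Ot u t : O u -> `|u t - p| < d.
  by move=> Ou; apply: le_lt_trans Ou; exact: (le_cpath_norm (u - cpath_cst p)).
have OU u : O u -> paths_in U u.
  by move=> Ou t; apply: HdU; apply: lt_trans ddU; exact: Ot.
have etad : eta * d^-1 <= 2^-1 /\ eta * d^-1 <= d / 4.
  rewrite !ler_pdivrMr// /eta !ge_min; split; apply/orP; [left|right]; lra.
have speed_le q u (B : R) (g : 'I_r -> E) : W q -> 0 <= B ->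
    (forall i, `|g i| <= d^-1 * B) ->
    `|\sum_i transv i q *: g i| <= eta * d^-1 * B.
  move=> Wq B0 gB; have [_ xW] := WE _ Wq.
  apply: le_trans (ler_norm_sum _ _ _) _.
  apply: (@le_trans _ _ (\sum_i `|transv i q| * (d^-1 * B))).
    by apply: ler_sum => i _; rewrite normrZ ler_wpM2l.
  rewrite -mulr_suml -mulrA; apply: ler_wpM2r; last exact: ltW.
  by rewrite mulr_ge0// invr_ge0 ltW.
have speedL q u u' : W q -> O u -> O u' ->
    `|speed q u - speed q u'| <= 2^-1 * `|u - u'|.
  move=> Wq Ou Ou'; rewrite /speed -sumrB.
  under eq_bigr do rewrite -scalerBr.
  apply: (@le_trans _ _ (eta * d^-1 * `|u - u'|)).
    apply: speed_le => // i; apply: cpath_norm_le => t _; rewrite cpathB !nemE; last 2 first.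
    - by apply: Ycont; exact: OU.
    - by apply: Ycont; exact: OU.
    have [_ _ _ L] := Hd i (u t) (Ot u t Ou).
    apply: le_trans (L _ (Ot u' t Ou')) _.
    rewrite ler_wpM2l ?invr_ge0 ?(ltW d0)//; exact: (le_cpath_norm (u - u')).
  by rewrite ler_wpM2r//; exact: etad.1.
have speedL' q v u w w' : W q -> O u ->
    `|dspeed q v u w - dspeed q v u w'| <= 2^-1 * `|w - w'|.
  move=> Wq Ou; have -> : dspeed q v u w - dspeed q v u w' = \sum_i transv i q *:
      (nem (tang (Y i)) (cpair (u, w)) - nem (tang (Y i)) (cpair (u, w'))).
    rewrite /dspeed -sumrB; apply: eq_bigr => i _.
    by rewrite opprD addrACA subrr addr0 -scalerBr.
  apply: (@le_trans _ _ (eta * d^-1 * `|w - w'|)).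
    apply: speed_le => // i; apply: cpath_norm_le => t _; rewrite cpathB !nemE; last 2 first.
    - by apply: tYcont; exact: OU.
    - by apply: tYcont; exact: OU.
    have [_ _ L _] := Hd i (u t) (Ot u t Ou).
    have -> : tang (Y i) (cpair (u, w) t) - tang (Y i) (cpair (u, w') t) =
        tang (Y i) (u t, w t - w' t) by rewrite /tang /= linearB.
    apply: le_trans (L _) _.
    rewrite ler_wpM2l ?invr_ge0 ?(ltW d0)//; exact: (le_cpath_norm (w - w')).
  by rewrite ler_wpM2r//; exact: etad.1.
have speedB q u : W q -> O u -> `|speed q u| <= d / 4.
  move=> Wq Ou; apply: (@le_trans _ _ (eta * d^-1 * 1)); last by rewrite mulr1; exact: etad.2.
  apply: speed_le => // i; rewrite mulr1; apply: cpath_norm_le => t _.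
  rewrite nemE; last by apply: Ycont; exact: OU.
  by have [] := Hd i (u t) (Ot u t Ou).
have contr q u u' : W q -> O u -> O u' ->
    `|flow_map (q, u) - flow_map (q, u')| <= 2^-1 * `|u - u'|.
  move=> Wq Ou Ou'; have -> : flow_map (q, u) - flow_map (q, u') =
      prim (speed q u' - speed q u).
    by rewrite /flow_map /= opprB addrC subrKA linearB.
  by apply: le_trans (le_prim _) _; rewrite distrC; exact: speedL.
(* Banach's theorem needs a closed invariant set. Starting points lie within d/4 of p and the
   displacement is at most d/4, so the ball of radius d/2 is invariant; smooth dependence is then
   applied on the larger open ball [O]. *)
pose C := closed_ball_ Num.norm (cpath_cst p) (d / 2).
have CO u : C u -> O u.
  by rewrite /C /closed_ball_ /O /= distrC => /le_lt_trans; apply; lra.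
have /choice[phi Hphi] : forall q, exists u, W q -> O u /\ u = flow_map (q, u).
  move=> q; have [Wq|nWq] := pselect (W q); last by exists 0.
  have [] := @half_contraction_fix _ _ C (fun u => flow_map (q, u)).
  - exact: closed_closed_ball_.
  - by exists (cpath_cst p); rewrite /C /closed_ball_ /= subrr normr0; lra.
  - move=> u /CO Ou; rewrite /C /closed_ball_ /=.
    have -> : cpath_cst p - flow_map (q, u) =
        (cpath_cst p - cpath_cst q) + prim (speed q u).
      by rewrite /flow_map /= opprB addrCA addrC.
    apply: le_trans (ler_normD _ _) _.
    have := le_trans (le_prim _) (speedB _ _ Wq Ou).
    have : `|cpath_cst p - cpath_cst q| <= d / 4.
      apply: cpath_norm_le => t _; rewrite cpathB /= distrC.
      by apply: ltW; exact: (WE _ Wq).1.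
    by lra.
  - by move=> u u' /CO Ou /CO Ou'; exact: contr.
  by move=> u /CO Ou uE; exists u.
have phiO q : W q -> O (phi q) by move=> /Hphi[].
have phiE q : W q -> phi q = flow_map (q, phi q) by move=> /Hphi[].
have phiU q : W q -> paths_in U (phi q) by move=> /phiO/OU.
have oWO : open [set z : 'rV[R]_n * E | W z.1 /\ O z.2].
  apply: openI; first exact: open_fst.
  by apply: (@open_comp _ _ snd) => // z _; exact: cvg_snd.
have Tflow k : Tk k [set z : 'rV[R]_n * E | W z.1 /\ O z.2] flow_map.
  apply: TkB => //.
    by apply: (Tk_comp (U' := setT) oWO _ (Tk_fst _ _) (Tk_cpath_cst _ _)).
  apply: (Tk_comp (U' := setT) oWO _ _ (Tk_prim _ _)) => //.
  apply: Tk_sum => // i; apply: Tk_scale => //.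
    by apply: (Tk_comp oWO _ (Tk_fst _ _) (Tk_transv k i oW)) => z [].
  apply: (Tk_comp oWO _ (Tk_snd _ _) (nem_Tk k oU (YT i))).
  by move=> z [_ /OU].
have Tphi k : Tk k W phi.
  by apply: (Tk_fixed_point oW oO phiO phiE contr (Tflow k)).
have dphi q : W q -> differentiable phi q by have [H _] := Tphi 1; exact: H.
exists W, (fun q => phi q 1); split=> //.
- by move=> q /WE[qd _]; apply: HdU; apply: lt_trans ddU; lra.
- by move=> k; apply: (Tk_comp (U' := setT) oW _ (Tphi k) (Tk_eval _ _ _)).
- move=> q i Wq; rewrite diff_eval; last exact: dphi.
  have phiqU := phiU _ Wq; have phiqE := phiE _ Wq.
  have := linearized_solution i phiqU phiqE.
  set w := CPath _ => wE.
  have wdE := flow_equation_diff (Y i q) oW phiU phiE (Tphi 1) Wq.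
  set w' := 'd phi q (Y i q) in wdE *.
  (* The explicit solution carries the factor 1 - t, which vanishes at t = 1, where H is evaluated.
     It equals the derivative of phi since the linearized equation is a contraction and has only one
     solution. *)
  suff -> : w' = w by rewrite /w /= clamp01_id ?lexx ?ler01// subrr scale0r.
  apply/eqP; rewrite -subr_eq0 -normr_le0.
  have : `|w' - w| <= 2^-1 * `|w' - w|.
    have wE' : w' - w = prim (dspeed q (Y i q) (phi q) w - dspeed q (Y i q) (phi q) w').
      by rewrite {1}wdE {1}wE opprB addrC subrKA linearB.
    rewrite {1}wE'; apply: le_trans (le_prim _) _.
    by rewrite [`|w' - w|]distrC; exact: (speedL' _ _ _ _ _ Wq (phiO _ Wq)).
  have := normr_ge0 (w' - w); lra.
move=> v vA; rewrite diff_eval; last exact: dphi.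
rewrite (flow_equation_diff v oW phiU phiE (Tphi 1) Wp).
(* At p all coefficients x_i vanish, and so do their derivatives along v in the kernel of A; the
   derivative of phi is then the constant path v. *)
have -> : dspeed p v (phi p) ('d phi p v) = 0.
  rewrite /dspeed big1// => i _.
  by rewrite transv_p vA mxE !scale0r addr0.
by rewrite linear0 subr0.
Qed.

End FirstIntegrals.

(** * Symmetry of the second derivative *)

Section SecondDerivative.
Context {R : realType} {V : normedModType R} {m : nat}.
Variables (U : set V) (H : V -> 'rV[R]_m).
Hypotheses (oU : open U) (TH : Tk 2 U H).

(** The second derivative of H at q in the directions v and w: the fibre vector w is frozen while
    the base point moves along v. *)
Definition diff2 (q v w : V) : 'rV[R]_m := 'd (tang H) (q, w) (v, 0).

Lemma tang_differentiable q w : U q -> differentiable (tang H) (q, w).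
Proof. by move=> Uq; have [_ [dt _]] := TH; exact: dt. Qed.

(** The tangent map is linear in its fibre variable, so it is its own derivative in that
    variable. *)
Lemma tang_diff_snd q w v : U q -> 'd (tang H) (q, w) (0, v) = 'd H q v.
Proof.
move=> Uq; have dt := tang_differentiable w Uq.
have dg : is_derive (0 : R) 1 (fun s : R => (q, w) + s *: ((0 : V), v)) (0, v).
  exact: is_derive_line.
have e0 : (q, w) + (0 : R) *: ((0 : V), v) = (q, w) by rewrite scale0r addr0.
have dt' : differentiable (tang H) ((q, w) + (0 : R) *: ((0 : V), v)) by rewrite e0.
have [_ E1] := is_derive_comp dg dt'; rewrite e0 in E1.
rewrite -E1.
have -> : tang H \o (fun s : R => (q, w) + s *: ((0 : V), v)) =
    (fun s : R => 'd H q w + s *: 'd H q v).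
  apply/funext => s /=; rewrite -linearZ -linearD /tang /=.
  by rewrite scaler0 addr0.
by have [_ ->] := is_derive_line ('d H q w) ('d H q v) 0.
Qed.

(** The second derivative becomes a limit of second differences of H, an expression in which v and w
    can be exchanged. *)
Lemma second_difference q v w : U q -> forall e, 0 < e -> exists2 d, 0 < d &
  forall s, 0 < s < d ->
   `|H (q + s *: v + s *: w) - H (q + s *: w) - H (q + s *: v) + H q
     - (s * s) *: diff2 q v w| <= e * (s * s).
Proof.
move=> Uq e e0.
pose c := `|v| + `|w| + 1.
have c0 : 0 < c by rewrite ltr_wpDl// addr_ge0.
have ec : 0 < e / (2 * c) by rewrite divr_gt0// mulr_gt0.
have [d1 d10 Hd1] := differentiable_estimate (tang_differentiable w Uq) ec.
have /nbhs_normP[d2 /= d20 Hd2] : \forall y \near q, U y by exact: open_nbhs_nbhs.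
exists (Num.min d1 d2 / c); first by rewrite divr_gt0// lt_min d10.
move=> s /andP[s0 sd].
have scd : s * c < Num.min d1 d2 by rewrite -ltr_pdivlMr.
have [scd1 scd2] : s * c < d1 /\ s * c < d2.
  by move: scd; rewrite lt_min => /andP[].
have small y : `|y| <= s * c -> U (q + y) /\
    `|'d H (q + y) w - 'd H q w - diff2 q y w| <= e / 2 * s.
  move=> ys; split.
    apply: Hd2; rewrite /= opprD addrA subrr sub0r normrN.
    exact: le_lt_trans scd2.
  have := Hd1 (y, 0); rewrite prod_normE /= normr0 max_l//.
  move=> /(_ (le_lt_trans ys scd1)) Hy.
  have -> : 'd H (q + y) w = tang H ((q, w) + (y, 0)) by rewrite /tang /= addr0.
  apply: le_trans Hy _; apply: (@le_trans _ _ (e / (2 * c) * (s * c))).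
    by rewrite ler_wpM2l// ltW.
  by rewrite le_eqVlt; apply/orP; left; apply/eqP; field; rewrite gt_eqF.
have D2D y z : diff2 q (y + z) w = diff2 q y w + diff2 q z w.
  by rewrite /diff2 -linearD; congr ('d _ _ _); apply/pair_equal_spec; rewrite /= addr0.
have D2Z a y : diff2 q (a *: y) w = a *: diff2 q y w.
  by rewrite /diff2 -linearZ; congr ('d _ _ _); apply/pair_equal_spec; rewrite /= scaler0.
(* Over a in [0, 1] this compares the increments of H along two parallel sides of the parallelogram
   and removes their expected difference; its derivative in a is small because [tang H] is
   differentiable at (q, w). *)
pose g (a : R) := H (q + s *: v + a *: (s *: w)) - H (q + a *: (s *: w))
  - a *: ((s * s) *: diff2 q v w).
have := @mean_value_rV R R m g 0 1 (e * (s * s)).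
have -> : g (0 + 1) = H (q + s *: v + s *: w) - H (q + s *: w)
    - (s * s) *: diff2 q v w by rewrite add0r /g !scale1r.
have -> : g 0 = H (q + s *: v) - H q by rewrite /g !scale0r !addr0 subr0.
move=> M.
have -> : H (q + s *: v + s *: w) - H (q + s *: w) - H (q + s *: v) + H q
    - (s * s) *: diff2 q v w =
    H (q + s *: v + s *: w) - H (q + s *: w) - (s * s) *: diff2 q v w
    - (H (q + s *: v) - H q).
  set x1 := H _; set x2 := H _; set x3 := H _; set x4 := H _; set y := _ *: _.
  by apply/rowP => j; rewrite !mxE; ring.
apply: M => a /andP[a0 a1]; rewrite add0r [a *: 1]mulr1.
have n1 : `|s *: v + a *: (s *: w)| <= s * c.
  apply: le_trans (ler_normD _ _) _; rewrite !normrZ (gtr0_norm s0) (ger0_norm a0).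
  have : a * (s * `|w|) <= s * `|w| by rewrite ler_piMl// mulr_ge0// ltW.
  by rewrite /c !mulrDr mulr1; lra.
have n2 : `|a *: (s *: w)| <= s * c.
  rewrite !normrZ (gtr0_norm s0) (ger0_norm a0).
  have : a * (s * `|w|) <= s * `|w| by rewrite ler_piMl// mulr_ge0// ltW.
  have : 0 <= s * `|v| by rewrite mulr_ge0// ltW.
  by rewrite /c !mulrDr mulr1; lra.
have [U1 B1] := small _ n1; have [U2 B2] := small _ n2.
have dH y : U y -> differentiable H y by have [dH _] := TH; exact: dH.
have D1 : is_derive a 1 (fun a : R => H (q + s *: v + a *: (s *: w)))
    ('d H (q + (s *: v + a *: (s *: w))) (s *: w)).
  have l1 := is_derive_line (q + s *: v) (s *: w) a.
  rewrite addrA; apply: (is_derive_comp l1).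
  by apply: dH; rewrite -addrA.
have D2 : is_derive a 1 (fun a : R => H (q + a *: (s *: w)))
    ('d H (q + a *: (s *: w)) (s *: w)).
  by apply: (is_derive_comp (is_derive_line q (s *: w) a)); exact: dH.
have D3 : is_derive a 1 (fun a : R => a *: ((s * s) *: diff2 q v w))
    ((s * s) *: diff2 q v w).
  have := is_derive_line 0 ((s * s) *: diff2 q v w) a.
  by under eq_fun do rewrite add0r.
have Dg := is_deriveB (is_deriveB D1 D2) D3.
have dg : differentiable g a by apply/derivable1_diffP; exact: (@ex_derive _ _ _ _ _ _ _ Dg).
split=> //.
rewrite -deriveE//; have [_ ->] := Dg.
have dHZ y : 'd H y (s *: w) = s *: 'd H y w by rewrite linearZ.
rewrite !dHZ.
set k1 := 'd H _ w in B1 *; set k2 := 'd H _ w in B2 *.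
have -> : s *: k1 - s *: k2 - (s * s) *: diff2 q v w = s *: (k1 - k2 - s *: diff2 q v w).
  by rewrite !scalerBr scalerA.
rewrite normrZ (gtr0_norm s0) mulrCA (ler_pM2l s0).
have -> : k1 - k2 - s *: diff2 q v w =
  (k1 - 'd H q w - diff2 q (s *: v + a *: (s *: w)) w) -
  (k2 - 'd H q w - diff2 q (a *: (s *: w)) w).
  rewrite D2D D2Z; set k := 'd H q w; set x := s *: _; set y := diff2 _ _ _.
  by apply/rowP => j; rewrite !mxE; ring.
apply: le_trans (ler_normB _ _) _; move: B1 B2; lra.
Qed.

Lemma diff2_sym q v w : U q -> diff2 q v w = diff2 q w v.
Proof.
move=> Uq; apply/eqP; rewrite -subr_eq0 -normr_le0; apply/ler_addgt0Pr => e e0; rewrite add0r.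
have e2 : 0 < e / 2 by lra.
have [d1 d10 H1] := second_difference v w Uq e2.
have [d2 d20 H2] := second_difference w v Uq e2.
pose s := Num.min d1 d2 / 2.
have s0 : 0 < s by rewrite divr_gt0// lt_min d10.
have smin : s < Num.min d1 d2 by rewrite ltr_pdivrMr// ltr_pMr ?ltr1n// lt_min d10.
have [sd1 sd2] : s < d1 /\ s < d2 by move: smin; rewrite lt_min => /andP[].
have := H1 s; rewrite s0 sd1 => /(_ isT) {}H1.
have := H2 s; rewrite s0 sd2 => /(_ isT) {}H2.
have E : H (q + s *: w + s *: v) - H (q + s *: v) - H (q + s *: w) + H q =
    H (q + s *: v + s *: w) - H (q + s *: w) - H (q + s *: v) + H q.
  by rewrite [q + s *: w + _]addrAC; apply/rowP => j; rewrite !mxE; ring.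
rewrite E in H2; set D := _ + H q in H1 H2.
have ss0 : 0 < s * s by rewrite mulr_gt0.
have : `|(s * s) *: (diff2 q v w - diff2 q w v)| <= e * (s * s).
  rewrite scalerBr; set x := _ *: diff2 q v w in H1 *; set y := _ *: diff2 q w v in H2 *.
  have -> : x - y = (D - y) - (D - x) by rewrite opprB [RHS]addrC subrKA.
  apply: le_trans (ler_normB _ _) _; move: H1 H2; lra.
by rewrite normrZ (gtr0_norm ss0) mulrC ler_pM2r.
Qed.

Lemma tang_field_diff (X : V -> V) q v : U q -> differentiable X q ->
  differentiable (fun y => tang H (y, X y)) q /\
  'd (fun y => tang H (y, X y)) q v = diff2 q v (X q) + 'd H q ('d X q v).
Proof.
move=> Uq dX.
have did : differentiable (id : V -> V) q by exact: ex_diff.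
have dp : differentiable (fun y => (y, X y)) q by exact: differentiable_pair.
have [d dE] := diff_compE dp (tang_differentiable (X q) Uq).
split=> //; apply: etrans (dE v) _.
have -> : 'd (fun y => (y, X y)) q v = (v, 'd X q v).
  apply: etrans (congr1 (@^~ v) (diff_pair did dX)) _ => /=.
  have idE := congr1 (@^~ v) (@diff_val _ _ _ _ _ _ _ (is_diff_id q)).
  exact: (congr1 (fun y => (y, 'd X q v)) idE).
have -> : (v, 'd X q v) = (v, 0) + (0, 'd X q v).
  by apply/pair_equal_spec; rewrite /= addr0 add0r.
apply: etrans (linearD _ _ _) _; congr (_ + _).
exact: tang_diff_snd.
Qed.

(** This is Z(Xh) = X(Zh) - [X, Z]h with Zh = 0, for each coordinate h of H. Differentiating Zh = 0
    along X and symmetry of the second derivative give it. *)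
Lemma derive_first_integral (X Z : V -> V) q : U q ->
  differentiable X q -> differentiable Z q ->
  (forall y, U y -> 'd H y (Z y) = 0) ->
  'd (fun y => tang H (y, X y)) q (Z q) =
    - 'd H q ('d Z q (X q) - 'd X q (Z q)).
Proof.
move=> Uq dX dZ HZ.
have [_ EZ] := tang_field_diff (X q) Uq dZ.
have [_ EX] := tang_field_diff (Z q) Uq dX.
have E0 : 'd (fun y => tang H (y, Z y)) q (X q) = 0.
  have n0 : {near q, cst (0 : 'rV[R]_m) =1 (fun y => tang H (y, Z y))}.
    by apply: filterS (open_nbhs_nbhs (conj oU Uq)) => y Uy; rewrite /tang /= HZ.
  have [_ ->] := near_eq_differentiable n0 (differentiable_cst (0 : 'rV[R]_m) q).
  by rewrite diff_cst.
have {}EZ := etrans (esym E0) EZ.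
have E : diff2 q (X q) (Z q) = - 'd H q ('d Z q (X q)).
  by apply/eqP; rewrite -addr_eq0; apply/eqP; exact: esym EZ.
have S := etrans (diff2_sym (Z q) (X q) Uq) E.
have L : 'd H q ('d Z q (X q) - 'd X q (Z q)) =
    'd H q ('d Z q (X q)) - 'd H q ('d X q (Z q)) by exact: linearB.
apply: etrans EX _; rewrite L opprB addrC; congr (_ + _); exact: S.
Qed.

End SecondDerivative.

(** * Commuting frames of involutive distributions *)

Section CommutingFrame.
Context {R : realType} {n r : nat}.
Variables (U : set 'rV[R]_n) (p : 'rV[R]_n) (Z : 'I_r -> vector_field R n).

Definition frame_mx (q : 'rV[R]_n) : 'M[R]_(r, n) := \matrix_(i < r) Z i q.

Hypotheses (oU : open U) (Up : U p).
Hypothesis ZT : forall i k, Tk k U (Z i).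
Hypothesis Zfree : row_free (frame_mx p).
Hypothesis Zinv : forall k l q, U q ->
  ('d (Z l) q (Z k q) - 'd (Z k) q (Z l q) <= frame_mx q)%MS.

(** As the frame has full row rank at p, this pseudo-inverse is a right inverse there: N(p) is the
    identity, and N stays invertible nearby. *)
Let A : 'M[R]_(n, r) := pinvmx (frame_mx p).
Let N q : 'M[R]_r := frame_mx q *m A.
(** The entries of N(q)^-1 by Cramer's rule, so that their smoothness reduces to that of
    determinants. *)
Let a i k q : R^o := (\det (N q))^-1 * cofactor (N q) k i.
Let Y i : vector_field R n := fun q => \sum_k a i k q *: Z k q.
Let U' := [set q | U q /\ \det (N q) != 0].

Lemma open_nonzero (f : 'rV[R]_n -> R^o) : Tk 0 U f ->
  open [set q | U q /\ f q != 0].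
Proof.
move=> Tf; rewrite openE => q [Uq fq]; apply: filterI.
  exact: open_nbhs_nbhs.
apply: (Tf q Uq [set x : R^o | x != 0]).
by apply: open_nbhs_nbhs; split; [exact: open_neq0|].
Qed.

Let TkN k i j : Tk k U (fun q => N q i j : R^o).
Proof.
apply: (@Tk_ext R k _ R^o U (fun q => \sum_l Z i q 0 l *: A l j : R^o) _ oU).
  by move=> q _; rewrite /N mxE; apply: eq_bigr => l _; congr (_ * _); rewrite mxE.
apply: Tk_sum => // l; apply: Tk_scale => //; last exact: Tk_cst.
by apply: Tk_coord => //; exact: ZT.
Qed.

Let Tk_detN k : Tk k U (fun q => \det (N q) : R^o).
Proof.
apply: (@Tk_ext R k _ R^o U (fun q => \det (\matrix_(i, j) N q i j) : R^o) _ oU).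
  by move=> q _; congr (\det _); apply/matrixP => i j; rewrite mxE.
by apply: Tk_det => // i j; exact: TkN.
Qed.

Let oU' : open U'. Proof. exact: open_nonzero (Tk_detN 0). Qed.

Let U'U : U' `<=` U. Proof. by move=> q []. Qed.

Let Tka k i j : Tk k U' (a i j).
Proof.
apply: TkM => //.
  apply: TkV => //; first by move=> q [].
  exact: Tk_sub U'U (Tk_detN k).
apply: TkM => //; first exact: Tk_cst.
apply: (@Tk_ext R k _ R^o U'
  (fun q => \det (\matrix_(s, t) N q (lift j s) (lift i t)) : R^o) _ oU').
  by move=> q _; congr (\det _); apply/matrixP => s t; rewrite !mxE.
apply: Tk_det => // s t; exact: Tk_sub U'U (TkN k _ _).
Qed.

Let aE q i k : U' q -> a i k q = invmx (N q) i k.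
Proof.
move=> [_ dN]; rewrite /invmx unitmxE unitfE dN !mxE; exact: erefl.
Qed.

Let YE q i : U' q -> Y i q = row i (invmx (N q) *m frame_mx q).
Proof.
move=> U'q; apply/rowP => j; rewrite mxE [in RHS]mxE summxE.
by apply: eq_bigr => k _; rewrite mxE aE// [in RHS]mxE.
Qed.

Let unitN q : U' q -> N q \in unitmx.
Proof. by move=> [_ dN]; rewrite unitmxE unitfE. Qed.

Let YA q i : U' q -> Y i q *m A = delta_mx 0 i.
Proof.
move=> U'q; rewrite YE// -row_mul -mulmxA -/(N q) mulVmx ?unitN//.
by rewrite row1.
Qed.

Let Zrow q k : (Z k q <= frame_mx q)%MS.
Proof. by have := row_sub k (frame_mx q); rewrite rowK. Qed.

Let Ysub q i : (Y i q <= frame_mx q)%MS.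
Proof. by apply: summx_sub => k _; apply: scalemx_sub; exact: Zrow. Qed.

Lemma mulmxr_continuous m (B : 'M[R]_(n, m)) :
  continuous (fun v : 'rV[R]_n => v *m B).
Proof.
have TB : Tk 0 setT (fun v : 'rV[R]_n => v *m B).
  apply: Tk_rV => [|j]; first exact: openT.
  apply: (@Tk_ext R 0 'rV[R]_n R^o setT (fun v : 'rV[R]_n => \sum_l v 0 l *: B l j : R^o) _ openT).
    by move=> v _; rewrite mxE.
  apply: Tk_sum; first exact: openT.
  move=> l; apply: Tk_scale; [exact: openT| |exact: Tk_cst].
  by apply: Tk_coord; [exact: openT|exact: Tk_id].
by move=> v; exact: TB.
Qed.

Let dY q i : U' q -> differentiable (Y i) q.
Proof.
have TY : Tk 1 U' (Y i).
  apply: Tk_sum => // k; apply: Tk_scale => //; exact: Tk_sub U'U (ZT k 1).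
by have [H _] := TY; exact: H.
Qed.

Let dYE q i v : U' q -> 'd (Y i) q v =
  \sum_k (a i k q *: 'd (Z k) q v + 'd (a i k) q v *: Z k q).
Proof.
move=> U'q.
have dZ k : differentiable (Z k) q by have [H _] := ZT k 1; exact/H/U'U.
have da k : differentiable (a i k) q by have [H _] := Tka 1 i k; exact: H.
have sd k := diff_scaleE (da k) (dZ k).
have [_ SE] := @diff_sumE R _ _ _ (index_enum 'I_r)
  (fun k q => a i k q *: Z k q) q (fun k => (sd k).1).
apply: etrans (SE v) _; apply: eq_bigr => k _; exact: (sd k).2.
Qed.

Let dYA q i v : U' q -> 'd (Y i) q v *m A = 0.
Proof.
move=> U'q; have Lc : continuous (mulmxr A : 'rV[R]_n -> 'rV[R]_r).
  exact: mulmxr_continuous.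
have [_ LE] := diff_linear_comp Lc (dY i U'q).
have nc : {near q, cst (delta_mx 0 i : 'rV[R]_r) =1 (fun y => mulmxr A (Y i y))}.
  by apply: filterS (open_nbhs_nbhs (conj oU' U'q)) => y U'y; rewrite /= YA.
have [_ E] := near_eq_differentiable nc (differentiable_cst _ q).
have /= <- := LE v; rewrite E diff_cst; exact: erefl.
Qed.

(* The bracket of Y_i and Y_j lies in the span of the Z_k, on which v |-> v A is
   injective, and it is killed by A because Y_i A and Y_j A are constant. *)
Let Ycomm q i j : U' q -> 'd (Y i) q (Y j q) = 'd (Y j) q (Y i q).
Proof.
move=> U'q; apply: subr0_eq.
have DA : ('d (Y i) q (Y j q) - 'd (Y j) q (Y i q)) *m A = 0.
  apply: etrans (mulmxBl _ _ _) _.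
  by apply: etrans (congr2 (fun u v => u - v) (dYA _ _ U'q) (dYA _ _ U'q)) (subrr _).
have : ('d (Y i) q (Y j q) - 'd (Y j) q (Y i q) <= frame_mx q)%MS.
  (* Derivatives of the coefficients contribute multiples of the Z_k, already in the span; only the
     sums S, carrying the derivatives of the Z_k, need involutivity. *)
  pose S s t := \sum_k a s k q *: 'd (Z k) q (Y t q).
  have E s t : exists2 x, 'd (Y s) q (Y t q) = S s t + x & (x <= frame_mx q)%MS.
    exists (\sum_k 'd (a s k) q (Y t q) *: Z k q).
      by rewrite dYE// big_split.
    by apply: summx_sub => k _; apply: scalemx_sub; exact: Zrow.
  have [x Ex xs] := E i j; have [y Ey ys] := E j i.
  have DE := congr2 (fun u v => u - v) Ex Ey.
  apply: (eq_ind_r (fun w : 'rV[R]_n => (w <= frame_mx q)%MS) _ DE) => {DE Ex Ey}.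
  rewrite opprD addrACA; apply: addmx_sub; last first.
    by apply: addmx_sub => //; rewrite -scaleN1r; exact: scalemx_sub.
  (* Expanded over both indices, the difference of the two sums regroups into brackets of pairs of
     Z_k. *)
  have SE s t : S s t = \sum_k \sum_l (a s k q * a t l q) *: 'd (Z k) q (Z l q).
    apply: eq_bigr => k _; rewrite /Y linear_sum scaler_sumr.
    by apply: eq_bigr => l _; rewrite linearZ /= scalerA.
  rewrite !SE [X in _ - X]exchange_big -sumrB; apply: summx_sub => k _.
  rewrite -sumrB; apply: summx_sub => l _.
  rewrite [a j l q * _]mulrC -scalerBr; apply: scalemx_sub; apply: Zinv.
  exact: U'U.
move: DA; move: (_ - _) => D DA /submxP[c cE].
have cN : c *m N q = 0 by rewrite /N mulmxA -cE.
by rewrite cE -[c](mulmxK (unitN U'q)) cN !mul0mx.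
Qed.

Let U'p : U' p.
Proof. by split=> //; rewrite /N /A mulmxVp// det1 oner_eq0. Qed.

Lemma commuting_frame : exists (V : set 'rV[R]_n) (B : 'M[R]_(n, r))
    (Y : 'I_r -> vector_field R n),
  [/\ open V /\ V p, V `<=` U, (forall i k, Tk k V (Y i)),
      (forall i q, V q -> Y i q *m B = delta_mx 0 i) &
      (forall i j q, V q -> 'd (Y i) q (Y j q) = 'd (Y j) q (Y i q))] /\
  (forall i q, (Y i q <= frame_mx q)%MS) /\
  (forall i q, V q -> Z i q = \sum_k (Z i q *m B) 0 k *: Y k q).
Proof.
exists U', A, Y; split; first split=> //.
- move=> i k; apply: Tk_sum => // l; apply: Tk_scale => //.
  exact: Tk_sub U'U (ZT l k).
- by move=> i q; exact: YA.
- by move=> i j q; exact: Ycomm.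
split=> // i q U'q.
have -> : \sum_k (Z i q *m A) 0 k *: Y k q =
    (Z i q *m A) *m (invmx (N q) *m frame_mx q).
  rewrite [RHS]mulmx_sum_row; apply: eq_bigr => k _.
  by rewrite YE.
have -> : Z i q *m A = row i (N q) by rewrite row_mul rowK.
by rewrite -row_mul mulmxA mulmxV ?unitN// mul1mx rowK.
Qed.

End CommutingFrame.

(** * Spans and the symmetrizing factor *)

Section Spans.
Context {R : realType} {n : nat}.
Implicit Types (U W : set 'rV[R]_n).

Lemma smooth_onP (V : normedModType R) U (f : 'rV[R]_n -> V) : open U ->
  smooth_on U f <-> forall k, Tk k U f.
Proof.
move=> oU; split=> Hf k; first exact: Ck_Tk.
exact: Tk_Ck.
Qed.

Lemma smooth_on_sub (V : normedModType R) U W (f : 'rV[R]_n -> V) :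
  open U -> open W -> W `<=` U -> smooth_on U f -> smooth_on W f.
Proof.
move=> oU oW WU /(smooth_onP _ oU) Tf; apply/(smooth_onP _ oW) => k.
exact: Tk_sub WU (Tf k).
Qed.

Lemma smooth_on_differentiable (V : normedModType R) U (f : 'rV[R]_n -> V) q :
  smooth_on U f -> U q -> differentiable f q.
Proof. by move=> Sf Uq; have [H _] := Sf 1; exact: H. Qed.

Lemma lie_bracketE (X Y : vector_field R n) q :
  differentiable X q -> differentiable Y q ->
  lie_bracket X Y q = 'd Y q (X q) - 'd X q (Y q).
Proof. by move=> dX dY; rewrite /lie_bracket !deriveE. Qed.

Lemma lie_bracketC (X Y : vector_field R n) q :
  lie_bracket Y X q = - lie_bracket X Y q.
Proof. by rewrite /lie_bracket opprB. Qed.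

Lemma mem_span_on m U (B : 'I_m -> vector_field R n) k : open U ->
  span_on U B (B k).
Proof.
move=> oU; exists (fun i => cst (i == k)%:R); split.
  by move=> i; apply/(smooth_onP _ oU) => j; exact: Tk_cst.
move=> q Uq; rewrite (bigD1 k)//= eqxx scale1r big1 ?addr0// => i ik.
by rewrite (negbTE ik) scale0r.
Qed.

Lemma span_onN m U (B : 'I_m -> vector_field R n) X : open U ->
  span_on U B X -> span_on U B (fun q => - X q).
Proof.
move=> oU [a [Sa aE]]; exists (fun i q => - a i q); split.
  by move=> i; apply/(smooth_onP _ oU) => k; apply: TkN => //; exact: ((smooth_onP _ oU).1 (Sa i)).
by move=> q Uq; rewrite aE// -sumrN; apply: eq_bigr => i _; rewrite scaleNr.
Qed.

Lemma span_on_ext m U (B : 'I_m -> vector_field R n) X Y :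
  (forall q, U q -> X q = Y q) -> span_on U B X -> span_on U B Y.
Proof. by move=> XY [a [Sa aE]]; exists a; split=> // q Uq; rewrite -XY// aE. Qed.

Lemma span_on0 m U (B : 'I_m -> vector_field R n) : open U ->
  span_on U B (fun=> 0).
Proof.
move=> oU; exists (fun _ _ => 0); split.
  by move=> i; apply/(smooth_onP _ oU) => k; exact: Tk_cst.
by move=> q _; rewrite big1// => i _; rewrite scale0r.
Qed.

Lemma span_on_sub m U W (B : 'I_m -> vector_field R n) X : open U -> open W ->
  W `<=` U -> span_on U B X -> span_on W B X.
Proof.
move=> oU oW WU [a [Sa aE]]; exists a; split=> [i|q /WU Uq]; last exact: aE.
exact: smooth_on_sub (Sa i).
Qed.

Lemma diff_near_combination m W (B : 'I_m -> vector_field R n)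
    (a : 'I_m -> scalar_field R n) (X : vector_field R n) q v : open W ->
  (forall i, smooth_on W (B i)) -> (forall i, smooth_on W (a i)) ->
  (forall q, W q -> X q = \sum_i a i q *: B i q) -> W q ->
  differentiable X q /\
  'd X q v = \sum_i (a i q *: 'd (B i) q v + 'd (a i) q v *: B i q).
Proof.
move=> oW SB Sa XE Wq.
have sd i := diff_scaleE (smooth_on_differentiable (Sa i) Wq)
  (smooth_on_differentiable (SB i) Wq).
have [Sd SE] := @diff_sumE R _ _ _ (index_enum 'I_m)
  (fun i q => a i q *: B i q) q (fun i => (sd i).1).
have nX : {near q, (fun q => \sum_i a i q *: B i q) =1 X}.
  by apply: filterS (open_nbhs_nbhs (conj oW Wq)) => y Wy; rewrite XE.
have [dX dXE] := near_eq_differentiable nX Sd.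
split; first exact: dX.
apply: etrans (congr1 (@^~ v) dXE) _; apply: etrans (SE v) _.
by apply: eq_bigr => i _; exact: (sd i).2.
Qed.

Lemma smooth_derive_along W (b : scalar_field R n) (X : vector_field R n) :
  open W -> smooth_on W b -> smooth_on W X ->
  smooth_on W (fun q => 'd b q (X q) : R^o).
Proof.
move=> oW Sb SX; apply/(smooth_onP _ oW) => k.
have [_ Tb] := (smooth_onP b oW).1 Sb k.+1.
have Tp : Tk k W (fun q => (q, X q)).
  by apply: Tk_pair => //; [exact: Tk_id|exact: ((smooth_onP X oW).1 SX k)].
have WW q : W q -> [set z : 'rV[R]_n * 'rV[R]_n | W z.1] (q, X q) by [].
exact: (Tk_comp oW WW Tp Tb).
Qed.

Lemma smooth_combination m W (B : 'I_m -> vector_field R n)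
    (a : 'I_m -> scalar_field R n) (X : vector_field R n) : open W ->
  (forall i, smooth_on W (B i)) -> (forall i, smooth_on W (a i)) ->
  (forall q, W q -> X q = \sum_i a i q *: B i q) -> smooth_on W X.
Proof.
move=> oW SB Sa XE; apply/(smooth_onP _ oW) => k.
apply: (@Tk_ext R k _ _ W (fun q => \sum_i a i q *: B i q) X oW).
  by move=> q Wq; rewrite XE.
apply: Tk_sum => // i; apply: Tk_scale => //; first exact: ((smooth_onP _ oW).1 (Sa i)).
exact: ((smooth_onP _ oW).1 (SB i)).
Qed.

(** By the Leibniz rule, the bracket of two combinations is the sum of the a_i b_j [B_i, B_j] plus
    the sum of the (Y1 b_k - Y2 a_k) B_k, so brackets of generators suffice. *)
Lemma span_involutive m W (B : 'I_m -> vector_field R n) : open W ->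
  (forall i, smooth_on W (B i)) ->
  (forall i j, span_on W B (lie_bracket (B i) (B j))) ->
  is_involutive (span_on W B).
Proof.
move=> oW SB Binv Y1 Y2 [a [Sa aE]] [b [Sb bE]].
have /choice[c Hc] : forall ij : 'I_m * 'I_m, exists c : 'I_m -> scalar_field R n,
    (forall k, smooth_on W (c k)) /\
    (forall q, W q -> lie_bracket (B ij.1) (B ij.2) q = \sum_k c k q *: B k q).
  by move=> [i j]; exact: Binv.
have SY1 := smooth_combination oW SB Sa aE.
have SY2 := smooth_combination oW SB Sb bE.
exists (fun k q => \sum_i \sum_j (a i q * b j q) * c (i, j) k q +
   ('d (b k) q (Y1 q) - 'd (a k) q (Y2 q))); split.
  move=> k; apply/(smooth_onP _ oW) => l.
  have T f : smooth_on W f -> Tk l W (f : 'rV[R]_n -> R^o).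
    by move=> Sf; exact: ((smooth_onP _ oW).1 Sf l).
  apply: TkD => //; last first.
    by apply: TkB => //; apply: T; exact: smooth_derive_along.
  apply: Tk_sum => // i; apply: Tk_sum => // j; apply: TkM => //.
    by apply: TkM => //; apply: T.
  by apply: T; have [H _] := Hc (i, j); exact: H.
move=> q Wq.
have [d1 d1E] := diff_near_combination (Y2 q) oW SB Sa aE Wq.
have [d2 d2E] := diff_near_combination (Y1 q) oW SB Sb bE Wq.
apply: etrans (lie_bracketE d1 d2) _.
apply: etrans (congr2 (fun u v => u - v) d2E d1E) _.
rewrite !big_split /= opprD addrACA.
under [RHS]eq_bigr do rewrite scalerDl scalerBl.
rewrite big_split /= sumrB; congr (_ + _).
have E (s t : 'I_m -> scalar_field R n) (Y : vector_field R n) :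
    Y q = \sum_j t j q *: B j q ->
    \sum_i s i q *: 'd (B i) q (Y q) =
    \sum_i \sum_j (s i q * t j q) *: 'd (B i) q (B j q).
  move=> ->; apply: eq_bigr => i _; rewrite linear_sum scaler_sumr.
  by apply: eq_bigr => j _; rewrite linearZ /= scalerA.
have E2 := E b a Y1 (aE _ Wq); have E1 := E a b Y2 (bE _ Wq).
apply: etrans (congr2 (fun u v => u - v) E2 E1) _.
rewrite [X in X - _]exchange_big /= -sumrB.
under [RHS]eq_bigr do rewrite scaler_suml.
rewrite [RHS]exchange_big /=; apply: eq_bigr => i _; rewrite -sumrB.
under [RHS]eq_bigr do rewrite scaler_suml.
rewrite [RHS]exchange_big /=; apply: eq_bigr => j _.
under [RHS]eq_bigr do rewrite -scalerA.
rewrite -scaler_sumr [b j q * _]mulrC -scalerBr; congr (_ *: _).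
have [_ cE] := Hc (i, j); rewrite -(cE _ Wq); apply/esym/lie_bracketE.
  exact: smooth_on_differentiable (SB i) Wq.
exact: smooth_on_differentiable (SB j) Wq.
Qed.

End Spans.

Lemma diff_coord {R : realType} (V : normedModType R) m n
    (f : V -> 'M[R]_(m, n)) x v i j : differentiable f x ->
  'd (fun q => f q i j : R^o) x v = 'd f x v i j.
Proof.
move=> df; have lin : linear (fun M : 'M[R]_(m, n) => M i j : R^o).
  by move=> a M M'; rewrite !mxE.
pose L : {linear 'M[R]_(m, n) -> R^o} :=
  HB.pack (fun M : 'M[R]_(m, n) => M i j : R^o)
    (GRing.isLinear.Build _ _ _ _ (fun M : 'M[R]_(m, n) => M i j : R^o) lin).
have Lc : continuous L by exact: coord_continuous.
exact: (diff_linear_comp Lc df).2.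
Qed.

(** * Frames enlarged by one vector field *)

Section Adjoin.
Context {R : realType} {n r : nat}.
Implicit Types (Z : 'I_r -> vector_field R n) (X : vector_field R n).

Lemma adjoin_lift Z X i : adjoin Z X (lift ord_max i) = Z i.
Proof. by rewrite /adjoin liftK. Qed.

Lemma adjoin_max Z X : adjoin Z X ord_max = X.
Proof. by rewrite /adjoin unlift_none. Qed.

Lemma sum_adjoin Z X (a : 'I_r.+1 -> R) q :
  \sum_i a i *: adjoin Z X i q =
    a ord_max *: X q + \sum_i a (lift ord_max i) *: Z i q.
Proof.
rewrite (bigD1_ord ord_max)//= adjoin_max; congr (_ + _).
by apply: eq_bigr => i _; rewrite adjoin_lift.
Qed.

Lemma ord_max_ind (P : 'I_r.+1 -> Prop) :
  P ord_max -> (forall i, P (lift ord_max i)) -> forall i, P i.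
Proof. by move=> P1 P2 i; case: (unliftP ord_max i) => [j|] ->. Qed.

Lemma span_adjoin U Z X Y : open U -> span_on U Z Y -> span_on U (adjoin Z X) Y.
Proof.
move=> oU [a [Sa aE]].
exists (fun i => if unlift ord_max i is Some j then a j else cst 0); split.
  apply: ord_max_ind => [|i]; last by rewrite liftK.
  by rewrite unlift_none; apply/(smooth_onP _ oU) => k; exact: Tk_cst.
move=> q Uq; rewrite sum_adjoin unlift_none scale0r add0r aE//.
by apply: eq_bigr => i _; rewrite liftK.
Qed.

Lemma adjoin_notin_frame Z X q :
  row_free (\matrix_(i < r.+1) adjoin Z X i q) -> ~ (X q <= frame_mx Z q)%MS.
Proof.
move=> free /submxP[c cE].
(* The linear relation cZ - X = 0 as a row vector, with -1 in the last place, that of X. *)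
pose u : 'rV[R]_r.+1 :=
  \row_i (if unlift ord_max i is Some j then c 0 j else -1).
have uM : u *m (\matrix_(i < r.+1) adjoin Z X i q) = 0.
  rewrite mulmx_sum_row.
  under eq_bigr do rewrite rowK.
  rewrite (sum_adjoin Z X (u 0)) mxE unlift_none scaleN1r cE mulmx_sum_row.
  apply/eqP; rewrite addrC subr_eq0; apply/eqP; apply: eq_bigr => i _.
  by rewrite mxE liftK rowK.
have : u = 0.
  by apply: (row_free_inj free); rewrite uM mul0mx.
move=> /rowP/(_ ord_max); rewrite !mxE unlift_none => /eqP.
by rewrite oppr_eq0 oner_eq0.
Qed.

Lemma adjoin_scale_free Z X (f : scalar_field R n) q : f q != 0 ->
  row_free (\matrix_(i < r.+1) adjoin Z X i q) ->
  row_free (\matrix_(i < r.+1) adjoin Z (scale_field f X) i q).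
Proof.
move=> fq free; apply: inj_row_free => u uM.
pose u' : 'rV[R]_r.+1 :=
  \row_i (u 0 i * (if unlift ord_max i is Some j then 1 else f q)).
have u'M : u' *m (\matrix_(i < r.+1) adjoin Z X i q) = 0.
  rewrite -uM !mulmx_sum_row.
  under eq_bigr do rewrite rowK.
  under [RHS]eq_bigr do rewrite rowK.
  rewrite (sum_adjoin Z X (u' 0)) (sum_adjoin Z (scale_field f X) (u 0)).
  congr (_ + _); first by rewrite mxE unlift_none -scalerA.
  by apply: eq_bigr => i _; rewrite mxE liftK mulr1.
have u'0 : u' = 0.
  by apply: (row_free_inj free); rewrite u'M mul0mx.
apply/rowP; apply: ord_max_ind => [|i].
  move/rowP: u'0 => /(_ ord_max); rewrite !mxE unlift_none => /eqP.
  by rewrite mulf_eq0 (negbTE fq) orbF => /eqP.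
by move/rowP: u'0 => /(_ (lift ord_max i)); rewrite !mxE liftK mulr1.
Qed.

End Adjoin.

(** * Construction of the symmetrizing factor *)

Theorem theorem2p4 (R : realType) (n r : nat) (hrn : (r < n)%N)
  (U : set 'rV[R]_n) (hU : open U)
  (Z : 'I_r -> vector_field R n)
  (hZ : distribution_frame U Z)
  (hinv : is_involutive (span_on U Z))
  (X : vector_field R n)
  (hX : is_Cinf_symmetry U Z X) :
  forall p : 'rV[R]_n, U p ->
    exists W : set 'rV[R]_n,
      [/\ open W, W p, W `<=` U &
          exists f : scalar_field R n, is_symmetrizing_factor W Z X f].
Proof.
move=> p Up.
have [SZ freeZ] := hZ; have [SX freeX invX] := hX.
have ZT i : forall k, Tk k U (Z i) := (smooth_onP _ hU).1 (SZ i).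
have dZ i q : U q -> differentiable (Z i) q by exact: smooth_on_differentiable.
have dX q : U q -> differentiable X q by exact: smooth_on_differentiable.
have Zinv k l : span_on U Z (lie_bracket (Z k) (Z l)).
  by apply: hinv; exact: mem_span_on.
have [V [B [Y [[[oV Vp] VU YT YB Ycomm] [Ysub ZY]]]]] :
    exists (V : set 'rV[R]_n) (B : 'M[R]_(n, r)) (Y : 'I_r -> vector_field R n),
  [/\ open V /\ V p, V `<=` U, (forall i k, Tk k V (Y i)),
      (forall i q, V q -> Y i q *m B = delta_mx 0 i) &
      (forall i j q, V q -> 'd (Y i) q (Y j q) = 'd (Y j) q (Y i q))] /\
  (forall i q, (Y i q <= frame_mx Z q)%MS) /\
  (forall i q, V q -> Z i q = \sum_k (Z i q *m B) 0 k *: Y k q).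
  apply: (commuting_frame hU Up ZT (freeZ _ Up)) => k l q Uq.
  rewrite -lie_bracketE; [|exact: dZ|exact: dZ].
  have [a [_ ->//]] := Zinv k l; apply: summx_sub => i _; apply: scalemx_sub.
  by have := row_sub i (frame_mx Z q); rewrite rowK.
have [W0 [H [[oW0 W0p] W0V TH HY Hp]]] := first_integrals oV Vp YT YB Ycomm.
have W0U q : W0 q -> U q by move=> /W0V/VU.
have HZ i q : W0 q -> 'd H q (Z i q) = 0.
  move=> Wq; rewrite ZY; last exact: W0V.
  by rewrite linear_sum big1// => k _; rewrite linearZ /= HY// scaler0.
(* The component of X(p) in the kernel of B along the span of the frame. dH fixes it and kills the
   rest, so dH(X) = v at p. *)
pose v := X p - \sum_k (X p *m B) 0 k *: Y k p.
have vB : v *m B = 0.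
  rewrite /v mulmxBl mulmx_suml; apply/eqP; rewrite subr_eq0; apply/eqP.
  rewrite [LHS]row_sum_delta.
  by apply: eq_bigr => i _; rewrite -scalemxAl YB.
have HXp : 'd H p (X p) = v.
  rewrite -[in RHS](Hp v vB) linearB linear_sum [X in _ - X]big1 ?subr0// => k _.
  by rewrite linearZ /= HY// scaler0.
(* Since X(p) lies outside the span of the Z_k, v is nonzero; the j-th coordinate of H is the first
   integral h with Xh nonzero at p. *)
have [j vj] : exists j, v 0 j != 0.
  apply/existsP; rewrite -[X in is_true X]negbK negb_exists; apply/negP => /forallP v0.
  have v00 : v = 0.
    by apply/rowP => i; rewrite [RHS]mxE; have := v0 i; rewrite negbK => /eqP.
  have Xp : X p = \sum_k (X p *m B) 0 k *: Y k p by exact: subr0_eq.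
  apply: (adjoin_notin_frame (freeX p Up)); rewrite Xp.
  by apply: summx_sub => k _; apply: scalemx_sub; exact: Ysub.
pose G q := tang H (q, X q).
have TX : forall k, Tk k U X := (smooth_onP _ hU).1 SX.
have TG k : Tk k W0 G.
  have [_ T] := TH k.+1.
  have Tp : Tk k W0 (fun q => (q, X q)).
    by apply: Tk_pair => //; [exact: Tk_id|exact: Tk_sub W0U (TX k)].
  have WW q : W0 q -> [set z : 'rV[R]_n * 'rV[R]_n | W0 z.1] (q, X q) by [].
  exact: (Tk_comp oW0 WW Tp T).
pose g q : R^o := G q 0 j.
have Tg k : Tk k W0 g by apply: Tk_coord => //; exact: TG.
pose W := [set q | W0 q /\ g q != 0].
have oW : open W by exact: open_nonzero (Tg 0).
have WW0 : W `<=` W0 by move=> q [].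
have WU : W `<=` U by move=> q /WW0/W0U.
have Wp : W p by split=> //; rewrite /g /G /tang /= HXp.
pose f : scalar_field R n := fun q => (g q)^-1.
have f0 q : W q -> f q != 0 by move=> [_ gq]; rewrite invr_eq0.
have Sf : smooth_on W f.
  apply/(smooth_onP _ oW) => k; apply: TkV => //; first by move=> q [].
  exact: Tk_sub WW0 (Tg k).
have SfX : smooth_on W (scale_field f X).
  apply/(smooth_onP _ oW) => k; apply: Tk_scale => //.
    exact: (smooth_onP _ oW).1 Sf k.
  exact: Tk_sub WU (TX k).
(* The bracket of two generators of the enlarged span lies in it; the coefficient at the last index
   is lam_i, the others are the c_ik. *)
have /choice[al Hal] : forall i, exists a : 'I_r.+1 -> scalar_field R n,
    (forall k, smooth_on U (a k)) /\
    (forall q, U q -> lie_bracket X (Z i) q = \sum_k a k q *: adjoin Z X k q).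
  move=> i; apply: invX.
    by rewrite -[X in span_on _ _ X](adjoin_max Z X); exact: mem_span_on.
  by rewrite -[X in span_on _ _ X](adjoin_lift Z X i); exact: mem_span_on.
pose lam i : scalar_field R n := al i ord_max.
pose c i k : scalar_field R n := al i (lift ord_max k).
have XZ i q : U q -> lie_bracket X (Z i) q = lam i q *: X q + \sum_k c i k q *: Z k q.
  move=> Uq; have [_ ->//] := Hal i.
  exact: (sum_adjoin Z X (fun k => al i k q)).
have dG q : W0 q -> differentiable G q by have [D _] := TG 1; exact: D.
have GZ i q : W0 q -> 'd G q (Z i q) = - (lam i q *: G q).
  move=> Wq; have Uq := W0U _ Wq.
  apply: etrans (derive_first_integral oW0 (TH 2) Wq (dX _ Uq) (dZ i _ Uq) (HZ i)) _.
  congr (- _); rewrite -lie_bracketE; [|exact: dX|exact: dZ].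
  rewrite XZ// linearD linearZ linear_sum /= big1 ?addr0// => k _.
  by rewrite linearZ /= HZ// scaler0.
have gZ i q : W0 q -> 'd g q (Z i q) = - (lam i q * g q).
  move=> Wq; apply: etrans (diff_coord _ _ _ (dG _ Wq)) _.
  by rewrite (GZ i _ Wq) !mxE.
have fZ i q : W q -> 'd f q (Z i q) = lam i q * f q.
  move=> Wq; have dg : differentiable g q.
    by have [D _] := Tg 1; apply: D; exact: WW0.
  have gq0 : g q != 0 by have [] := Wq.
  apply: etrans (congr1 (@^~ (Z i q)) (diffV dg gq0)) _ => /=.
  rewrite gZ; last exact: WW0.
  by rewrite /f /GRing.scale /=; field.
have fXZ i q : W q ->
    lie_bracket (scale_field f X) (Z i) q = \sum_k (f q * c i k q) *: Z k q.
  move=> Wq; have Uq := WU _ Wq.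
  have df : differentiable f q by exact: smooth_on_differentiable Sf Wq.
  have [dfX dfXE] := diff_scaleE df (dX _ Uq).
  rewrite lie_bracketE; [|exact: dfX|exact: dZ].
  have := XZ i q Uq; rewrite lie_bracketE; [|exact: dX|exact: dZ] => XZq.
  have E1 : 'd (Z i) q (scale_field f X q) = f q *: 'd (Z i) q (X q).
    exact: linearZ.
  apply: etrans (congr2 (fun x y => x - y) E1 (dfXE (Z i q))) _.
  rewrite fZ// opprD addrA -scalerBr XZq scalerDr scalerA [f q * _]mulrC.
  rewrite addrAC subrr add0r scaler_sumr; apply: eq_bigr => k _.
  by rewrite scalerA.
have fXZ_span i : span_on W Z (lie_bracket (scale_field f X) (Z i)).
  exists (fun k q => f q * c i k q : R^o); split=> [k|q Wq]; last exact: fXZ.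
  apply/(smooth_onP _ oW) => m; apply: TkM => //.
    exact: (smooth_onP _ oW).1 Sf m.
  have [Sal _] := Hal i; apply: Tk_sub WU _.
  exact: (smooth_onP _ hU).1 (Sal _) m.
exists W; split=> //; exists f; split=> //; split.
  split=> //.
    by move=> q Wq; apply: adjoin_scale_free; [exact: f0|exact/freeX/WU].
  apply: span_involutive => //.
    apply: ord_max_ind => [|i]; first by rewrite adjoin_max.
    by rewrite adjoin_lift; exact: smooth_on_sub (SZ i).
  (* All four kinds of brackets of generators already lie in the span of the Z_k, since those of fX
     with the Z_i have no component along X. *)
  move=> i i'; apply: span_adjoin => //; move: i i'.
  apply: ord_max_ind => [|i]; apply: ord_max_ind => [|i'].
  - apply: span_on_ext (span_on0 Z oW) => q _.
    by rewrite adjoin_max /lie_bracket subrr.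
  - by rewrite adjoin_max adjoin_lift.
  - apply: span_on_ext (span_onN oW (fXZ_span i)) => q _.
    by rewrite adjoin_max adjoin_lift [RHS]lie_bracketC.
  - by rewrite !adjoin_lift; exact: span_on_sub (Zinv i i').
exists (fun _ _ => 0), (fun i k q => f q * c i k q : R^o); split=> //; split.
- by move=> i; apply/(smooth_onP _ oW) => k; exact: Tk_cst.
- move=> i k; apply/(smooth_onP _ oW) => m; apply: TkM => //.
    exact: (smooth_onP _ oW).1 Sf m.
  have [Sal _] := Hal i; apply: Tk_sub WU _.
  exact: (smooth_onP _ hU).1 (Sal _) m.
- by move=> i q Wq; rewrite scale0r add0r fXZ.
Qed.
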